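(* Let $d=1$, let $\Lambda_0\subset\mathbb{R}$ be an aperiodic and repetitive Delone set of finite local complexity with pattern space $\Omega$, and assume that the action of $\mathbb{R}$ on $\Omega$ by translations is uniquely ergodic with unique invariant probability measure $\mu$. Then the space $L^2(\Omega,\mu)$ of square integrable vector fields admits the Helmholtz-Hodge decomposition $$L^2(\Omega,\mu)=\operatorname{Im}\nabla\oplus(\operatorname{Im}\nabla)^\perp\simeq\operatorname{Im}\nabla\oplus\mathbb{R},$$ that is, $(\operatorname{Im}\nabla)^\perp$ is one-dimensional. More precisely, $$(\operatorname{Im}\nabla)^\perp=\star\{\text{constant functions on }\Omega\},$$ where $\star$ is the Hodge star operator.
   Context: Delone sets (here $d=1$). $\Lambda\subset\mathbb{R}^d$ is a Delone set if it is uniformly discrete (there is $\varepsilon>0$ with $|\vec x-\vec y|>\varepsilon$ for all distinct $\vec x,\vec y\in\Lambda$) and relatively dense (there is $R>0$ with $\Lambda\cap B_R(\vec x)\ne\varnothing$ for all $\vec x\in\mathbb{R}^d$). A cluster is a finite subset of $\Lambda$. $\Lambda$ has finite local complexity if for every $R>0$ there are finitely many clusters $P_1,\dots,P_n$ such that for each $\vec x\in\mathbb{R}^d$ the set $B_R(\vec x)\cap\Lambda$ is a translate of some $P_i$. It is aperiodic if $\Lambda-\vec t=\Lambda$ implies $\vec t=\vec 0$. It is repetitive if for every cluster $P\subset\Lambda$ there is $R_P>0$ such that for every $\vec x\in\mathbb{R}^d$ the set $B_{R_P}(\vec x)\cap\Lambda$ contains a translate of $P$. Pattern space. Write $\varphi_{\vec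 t}(\Lambda)=\Lambda-\vec t$. Put $\varrho(\Lambda_1,\Lambda_2)=\min\{\bar\varrho(\Lambda_1,\Lambda_2),2^{-1/2}\}$, where $\bar\varrho(\Lambda_1,\Lambda_2)$ is the infimum of all $\varepsilon>0$ such that there exist $\vec s,\vec t\in B_\varepsilon(\vec 0)$ with $B_{1/\varepsilon}(\vec 0)\cap\varphi_{\vec s}(\Lambda_1)=B_{1/\varepsilon}(\vec 0)\cap\varphi_{\vec t}(\Lambda_2)$. The pattern space $\Omega$ of $\Lambda_0$ is the closure of $\{\varphi_{\vec t}(\Lambda_0):\vec t\in\mathbb{R}^d\}$ with respect to the metric $\varrho$; it is a compact metric space of Delone sets on which $\mathbb{R}^d$ acts continuously by $\varphi$. Unique ergodicity means there is exactly one Borel probability measure $\mu$ on $\Omega$ invariant under all $\varphi_{\vec t}$. Gradient. For $f:\Omega\to\mathbb{R}$ put $f'(\Lambda)=\lim_{s\to0}\frac{f(\varphi_s(\Lambda))-f(\Lambda)}{s}$ when it exists; $C^\infty(\Omega)$ is the space of continuous functions all of whose iterated derivatives exist and are continuous on $(\Omega,\varrho)$. $\mathcal{W}^{1,2}(\Omega,\mu)$ is the space of $f\in L^2(\Omega,\mu)$ having a weak derivative $f'\in L^2(\Omega,\mu)$, i.e. $\int_\Omega f'\psi\,d\mu=-\int_\Omega f\psi'\,d\mu$ for all $\psi\in C^\infty(\Omega)$. A square integrable vector field is $v=g\,\vec e_1$ with $g\in L^2(\Omega,\mu)$, where $\vec e_1$ is the unit vector of $\mathbb{R}$; the space of these is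 identified with $L^2(\Omega,\mu)$. The gradient $\nabla f=f'\,\vec e_1$ is a densely defined closed operator with domain $\mathcal{W}^{1,2}(\Omega,\mu)$, and $\operatorname{Im}\nabla=\{\nabla f:f\in\mathcal{W}^{1,2}(\Omega,\mu)\}$; orthogonal complements are in $L^2(\Omega,\mu)$. Hodge star. Let $\mathcal{E}(f,g)=\frac12\int_\Omega f'g'\,d\mu$ on $\mathcal{D}(\mathcal{E})=\mathcal{W}^{1,2}(\Omega,\mu)$. The abstract space $\mathcal{H}$ of $L^2$-differential 1-forms of $\mathcal{E}$ is the Hilbert completion (after factoring out null elements) of $(\mathcal{D}(\mathcal{E})\cap C(\Omega))\otimes(\mathcal{D}(\mathcal{E})\cap C(\Omega))$ with $\langle a\otimes b,c\otimes e\rangle_{\mathcal{H}}=\mathcal{E}(abe,c)+\mathcal{E}(a,bce)-\mathcal{E}(ac,be)$; it is a direct integral over $\mu$ of one-dimensional Hilbert spaces $\mathcal{H}_\Lambda$, and is isometrically isomorphic to the space of square integrable vector fields, $\partial f=f\otimes\mathbf 1$ corresponding to $\nabla f$. For $\omega\in\mathcal{H}$ with $\|\omega\|_{\mathcal{H}_\Lambda}=1$ for $\mu$-a.e. $\Lambda$, the Hodge star operator with respect to $\omega$ is $\star_\omega f=f\cdot\omega$, a bijective isometry $L^2(\Omega,\mu)\to\mathcal{H}$, and its inverse is denoted by the same symbol. Here $\star$ is obtained by taking $\omega$ to be the 1-form corresponding to the constant vector field $\vec e_1$ and using the isometric isomorphism between $\mathcal{H}$ and the space of square integrable vector fields under which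 $\partial f=f\otimes\mathbf 1$ corresponds to $\nabla f$; concretely, $\star$ maps a vector field $g\,\vec e_1$ to the function $g$ and a function $g$ to the vector field $g\,\vec e_1$, so that $\star\nabla f=f'$ for $f\in\mathcal{D}(\mathcal{E})$.
   Formalization: In the orthogonal decomposition of L^2 the first summand is the L^2-closure of Im ∇, since Im ∇ itself need not be closed (e.g. for the Fibonacci chain) and the literal equality then fails; the orthogonal complement is that of Im ∇ as stated. *)

(* Defs.v *)
From HB Require Import structures.
From mathcomp Require Import all_boot all_order all_algebra.
From mathcomp Require Import all_classical all_reals all_analysis.
From mathcomp Require Import ring lra.

Set Implicit Arguments.
Unset Strict Implicit.
Unset Printing Implicit Defensive.

Import Order.TTheory GRing.Theory Num.Theory.
Import numFieldNormedType.Exports.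

Local Open Scope classical_set_scope.
Local Open Scope ring_scope.

Section DeloneSets.
Context {R : realType}.
Implicit Types (A L P : set R) (s t x y e r : R).

Definition translate t A : set R := [set x - t | x in A].

Definition uniformly_discrete L : Prop :=
  exists2 e : R, 0 < e & forall x y, L x -> L y -> x != y -> e < `|x - y|.

Definition relatively_dense L : Prop :=
  exists2 r : R, 0 < r & forall x, L `&` ball x r !=set0.

Definition is_delone L : Prop := uniformly_discrete L /\ relatively_dense L.

Definition is_cluster L P : Prop := finite_set P /\ P `<=` L.

Definition finite_local_complexity L : Prop :=
  forall r, 0 < r ->
  exists C : set (set R),
    [/\ finite_set C, (forall P, C P -> is_cluster L P) &
        forall x, exists2 P, C P & exists t, ball x r `&` L = translate t P].

Definition aperiodic L : Prop := forall t, translate t L = L -> t = 0.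

Definition repetitive L : Prop :=
  forall P, is_cluster L P ->
  exists2 r, 0 < r & forall x, exists t, translate t P `<=` ball x r `&` L.

Lemma translateE t A x : translate t A x <-> A (x + t).
Proof.
split=> [[y Ay <-]|Ax]; first by rewrite subrK.
by exists (x + t) => //; rewrite addrK.
Qed.

Lemma translate0 A : translate 0 A = A.
Proof.
apply/seteqP; split=> x; first by move/translateE; rewrite addr0.
by move=> Ax; apply/translateE; rewrite addr0.
Qed.

Lemma translateD s t A : translate s (translate t A) = translate (s + t) A.
Proof.
apply/seteqP; split=> x.
  by move=> /translateE/translateE; rewrite -addrA => ?; exact/translateE.
by move=> /translateE; rewrite addrA => ?; apply/translateE/translateE.
Qed.

Lemma is_delone_translate t L : is_delone L -> is_delone (translate t L).
Proof.
move=> [[e e0 He] [r r0 Hr]]; split.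
  exists e => // x y /translateE Lx /translateE Ly xy.
  have -> : x - y = (x + t) - (y + t) by ring.
  by apply: He => //; apply: contra_neq xy => /addIr.
exists r => // x; have [y [Ly xy]] := Hr (x + t).
exists (y - t); split; first by apply/translateE; rewrite subrK.
move: xy; rewrite -!ball_normE /=.
by have -> : x + t - y = x - (y - t) by ring.
Qed.

Definition e_close e (L1 L2 : set R) : Prop :=
  exists s t, [/\ ball (0 : R) e s, ball (0 : R) e t &
    ball (0 : R) e^-1 `&` translate s L1 = ball (0 : R) e^-1 `&` translate t L2].

Definition close_radii (L1 L2 : set R) : set R :=
  [set e | 0 < e /\ e_close e L1 L2].

Definition pattern_dist (L1 L2 : set R) : R :=
  Num.min (inf (close_radii L1 L2)) (Num.sqrt 2)^-1.

Lemma in_ball0 e x : ball (0 : R) e x <-> `|x| < e.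
Proof. by rewrite -ball_normE /= sub0r normrN. Qed.

Lemma e_closeP e L1 L2 : e_close e L1 L2 <->
  exists s t, [/\ `|s| < e, `|t| < e &
    forall x, `|x| < e^-1 -> (L1 (x + s) <-> L2 (x + t))].
Proof.
split=> -[s [t [ss tt H]]]; exists s, t.
  split; [exact/in_ball0|exact/in_ball0|] => x /in_ball0 xe.
  have := congr1 (fun A : set R => A x) H; rewrite /setI /= => E.
  split=> Lx.
    have : ball (0 : R) e^-1 x /\ translate s L1 x by split=> //; exact/translateE.
    by rewrite E => -[_ /translateE].
  have : ball (0 : R) e^-1 x /\ translate t L2 x by split=> //; exact/translateE.
  by rewrite -E => -[_ /translateE].
split; [exact/in_ball0|exact/in_ball0|].
apply/seteqP; split=> x [xe /translateE Lx]; split=> //; apply/translateE.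
  by apply/H => //; exact/in_ball0.
by apply/H => //; exact/in_ball0.
Qed.

Lemma e_close_refl e L : 0 < e -> e_close e L L.
Proof. by move=> e0; apply/e_closeP; exists 0, 0; rewrite normr0. Qed.

Lemma e_close_sym e L1 L2 : e_close e L1 L2 -> e_close e L2 L1.
Proof.
move=> /e_closeP[s [t [ss tt H]]]; apply/e_closeP; exists t, s; split=> // x xe.
by apply: iff_sym; exact: H.
Qed.

Lemma e_close_mono e e' L1 L2 : 0 < e -> e <= e' ->
  e_close e L1 L2 -> e_close e' L1 L2.
Proof.
move=> e0 ee /e_closeP[s [t [ss tt H]]]; apply/e_closeP; exists s, t; split.
- exact: lt_le_trans ee.
- exact: lt_le_trans ee.
- move=> x xe; apply: H; apply: lt_le_trans xe _.
  by rewrite lef_pV2 ?posrE//; exact: lt_le_trans ee.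
Qed.

Lemma e_close_trans e1 e2 L1 L2 L3 : 0 < e1 -> 0 < e2 -> e1 + e2 < 1 ->
  e_close e1 L1 L2 -> e_close e2 L2 L3 -> e_close (e1 + e2) L1 L3.
Proof.
move=> e10 e20 e1e2 /e_closeP[s1 [t1 [ss1 tt1 H1]]] /e_closeP[s2 [t2 [ss2 tt2 H2]]].
have key (a b : R) : 0 < a -> 0 < b -> a + b < 1 -> (a + b)^-1 + b <= a^-1.
  move=> a0 b0 ab; have ab0 : 0 < a + b by lra.
  have -> : a^-1 = (a + b)^-1 + b * (a^-1 * (a + b)^-1) by field; rewrite !gt_eqF.
  rewrite lerD2l ler_peMr ?(ltW b0)//.
  by rewrite -invfM invf_ge1 ?mulr_gt0//; nra.
apply/e_closeP; exists (s1 + s2), (t1 + t2); split.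
- by rewrite (le_lt_trans (ler_normD _ _))// ltrD.
- by rewrite (le_lt_trans (ler_normD _ _))// ltrD.
- move=> x xe.
  rewrite (_ : x + (s1 + s2) = (x + s2) + s1); last by ring.
  rewrite (_ : x + (t1 + t2) = (x + t1) + t2); last by ring.
  have E1 : L1 (x + s2 + s1) <-> L2 (x + s2 + t1).
    apply: H1; apply: le_lt_trans (ler_normD _ _) _.
    by apply: lt_le_trans (key _ _ e10 e20 e1e2); exact: ltrD.
  have E2 : L2 (x + t1 + s2) <-> L3 (x + t1 + t2).
    apply: H2; apply: le_lt_trans (ler_normD _ _) _.
    apply: lt_le_trans (key _ _ e20 e10 _); last by rewrite addrC.
    by rewrite [e2 + e1]addrC; exact: ltrD.
  apply: iff_trans E1 _; apply: iff_trans _ E2.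
  by rewrite (_ : x + s2 + t1 = x + t1 + s2)//; ring.
Qed.

Lemma delone_gap L : is_delone L ->
  exists s, exists2 r, 0 < r & forall x, `|x| < r -> ~ L (x + s).
Proof.
move=> [[e e0 He] [r r0 Hr]]; have [p [Lp _]] := Hr 0.
exists (p + e / 2), (e / 2); first by lra.
move=> x; rewrite ltr_norml => /andP[x1 x2] Lx.
have [xp|xp] := eqVneq (x + (p + e / 2)) p; first by lra.
have := He _ _ Lx Lp xp; have -> : x + (p + e / 2) - p = x + e / 2 by ring.
by rewrite ltNge ler_norml; lra.
Qed.

(* Hence the infimum in [pattern_dist] is over a nonempty set. *)
Lemma close_radii_nonempty L1 L2 : is_delone L1 -> is_delone L2 ->
  close_radii L1 L2 !=set0.
Proof.
move=> /delone_gap[s1 [r1 r10 H1]] /delone_gap[s2 [r2 r20 H2]].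
have n1 := normr_ge0 s1; have n2 := normr_ge0 s2.
have i1 : 0 < r1^-1 by rewrite invr_gt0.
have i2 : 0 < r2^-1 by rewrite invr_gt0.
set e := 1 + `|s1| + `|s2| + r1^-1 + r2^-1.
have e0 : 0 < e by rewrite /e; lra.
exists e; split=> //; apply/e_closeP; exists s1, s2; split.
- by rewrite /e; lra.
- by rewrite /e; lra.
- move=> x xe.
  have x1 : `|x| < r1.
    apply: lt_le_trans xe _; rewrite -[leRHS]invrK lef_pV2 ?posrE//.
    by rewrite /e; lra.
  have x2 : `|x| < r2.
    apply: lt_le_trans xe _; rewrite -[leRHS]invrK lef_pV2 ?posrE//.
    by rewrite /e; lra.
  by split=> [/(H1 _ x1)|/(H2 _ x2)].
Qed.

Lemma close_radii_lbound L1 L2 : lbound (close_radii L1 L2) 0.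
Proof. by move=> e [/ltW]. Qed.

Lemma close_radii_inf_ge0 L1 L2 : 0 <= inf (close_radii L1 L2).
Proof.
have [->|/set0P ne] := eqVneq (close_radii L1 L2) set0; first by rewrite inf0.
by apply: lb_le_inf => //; exact: close_radii_lbound.
Qed.

Lemma sqrt2V_gt0 : 0 < (Num.sqrt 2 : R)^-1.
Proof. by rewrite invr_gt0 sqrtr_gt0. Qed.

Lemma sqrt2V_lt1 : (Num.sqrt 2 : R)^-1 < 1.
Proof. by rewrite invf_lt1 ?sqrtr_gt0// -[ltLHS]sqrtr1 ltr_sqrt//; lra. Qed.

Lemma pattern_dist_ge0 L1 L2 : 0 <= pattern_dist L1 L2.
Proof. by rewrite le_min close_radii_inf_ge0 ltW ?sqrt2V_gt0. Qed.

Lemma pattern_dist_le e L1 L2 : 0 < e -> e_close e L1 L2 ->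
  pattern_dist L1 L2 <= e.
Proof.
move=> e0 c; rewrite ge_min; apply/orP; left; apply: ge_inf => //.
by exists 0; exact: close_radii_lbound.
Qed.

Lemma pattern_dist_lt e L1 L2 : is_delone L1 -> is_delone L2 ->
  e <= (Num.sqrt 2)^-1 -> pattern_dist L1 L2 < e -> e_close e L1 L2.
Proof.
move=> d1 d2 es; rewrite gt_min => /orP[|]; last by rewrite ltNge es.
move=> /inf_lt[]; first exact: close_radii_nonempty.
by move=> e' [e'0 c] /ltW e'e; exact: e_close_mono c.
Qed.

Lemma pattern_distxx L : pattern_dist L L = 0.
Proof.
apply/eqP; rewrite eq_le pattern_dist_ge0 andbT; apply/ler_addgt0Pl => e e0.
by rewrite addr0; apply: pattern_dist_le => //; exact: e_close_refl.
Qed.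

Lemma pattern_dist_sym L1 L2 : pattern_dist L1 L2 = pattern_dist L2 L1.
Proof.
by rewrite /pattern_dist; congr (Num.min (inf _) _); apply/seteqP;
  split=> e [e0 /e_close_sym].
Qed.

Lemma pattern_dist_triangle L2 L1 L3 : is_delone L1 -> is_delone L2 ->
  is_delone L3 ->
  pattern_dist L1 L3 <= pattern_dist L1 L2 + pattern_dist L2 L3.
Proof.
move=> d1 d2 d3; set c : R := (Num.sqrt 2)^-1.
have c1 : c < 1 := sqrt2V_lt1.
have p13 : pattern_dist L1 L3 <= c by rewrite ge_min lexx orbT.
have p12 := pattern_dist_ge0 L1 L2; have p23 := pattern_dist_ge0 L2 L3.
have [|lt] := lerP c (pattern_dist L1 L2 + pattern_dist L2 L3).
  exact: le_trans.
apply/ler_addgt0Pl => e e0.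
set D := pattern_dist L1 L2 + pattern_dist L2 L3 in lt *.
have [|lt'] := lerP c (e + D); first exact: le_trans.
set a := pattern_dist L1 L2 + e / 2; set b := pattern_dist L2 L3 + e / 2.
have -> : e + D = a + b by rewrite /a /b /D; field.
have abc : a + b < c by rewrite /a /b; move: lt'; rewrite /D; lra.
have a0 : 0 < a by rewrite /a; lra.
have b0 : 0 < b by rewrite /b; lra.
apply: pattern_dist_le; first by rewrite addr_gt0.
apply: (@e_close_trans _ _ _ L2) => //; first exact: lt_trans c1.
  by apply: pattern_dist_lt => //; rewrite -/c; rewrite /a /b in abc b0 *; lra.
by apply: pattern_dist_lt => //; rewrite -/c; rewrite /a /b in abc a0 *; lra.
Qed.

Lemma pattern_dist_positivity L1 L2 : is_delone L1 -> is_delone L2 ->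
  pattern_dist L1 L2 = 0 -> L1 = L2.
Proof.
move=> + + d0.
suff sub A B : is_delone A -> is_delone B -> pattern_dist A B = 0 -> A `<=` B.
  move=> d1 d2; apply/seteqP; split; first exact: sub.
  by apply: sub => //; rewrite pattern_dist_sym.
move=> dA dB {}d0 p Ap.
have near e : 0 < e -> exists2 q, B q & `|p - q| < e.
  move=> e0; pose d := Num.min (Num.min (e / 2) (`|p| + 1)^-1) (Num.sqrt 2)^-1.
  have p1 : 0 < `|p| + 1 by have := normr_ge0 p; lra.
  have dd : d > 0 by rewrite !lt_min divr_gt0// invr_gt0 p1 sqrt2V_gt0.
  have ds : d <= (Num.sqrt 2)^-1 by rewrite ge_min lexx orbT.
  have de : d <= e / 2 by rewrite !ge_min lexx.
  have dp : `|p| + 1 <= d^-1.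
    by rewrite -[leLHS]invrK lef_pV2 ?posrE ?invr_gt0// !ge_min lexx orbT.
  have d1 : d < 1 := le_lt_trans ds sqrt2V_lt1.
  have /e_closeP[s [t [sd td H]]] : e_close d A B.
    by apply: pattern_dist_lt => //; rewrite d0.
  have /H [BA _] : `|p - s| < d^-1.
    by apply: le_lt_trans (ler_normB _ _) _; lra.
  exists (p - s + t); first by apply: BA; rewrite subrK.
  have -> : p - (p - s + t) = s - t by ring.
  by apply: le_lt_trans (ler_normB _ _) _; lra.
have [[e e0 He] _] := dB.
have [q Bq pq] := near (e / 2) (divr_gt0 e0 (ltr0Sn R 1)).
have [<-//|npq] := eqVneq q p.
have pq0 : 0 < `|p - q| by rewrite normr_gt0 subr_eq0 eq_sym.
have [q' Bq' pq'] := near _ pq0.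
have qq' : q != q' by apply/eqP => qq'; move: pq'; rewrite qq' ltxx.
have := He _ _ Bq Bq' qq'; have -> : q - q' = (p - q') - (p - q) by ring.
by have := ler_normB (p - q') (p - q); lra.
Qed.

Lemma e_close_translate e t L1 L2 : 0 < e ->
  e_close (e^-1 + `|t|)^-1 L1 L2 -> e_close e (translate t L1) (translate t L2).
Proof.
move=> e0 /e_closeP[s [u [sd ud H]]]; apply/e_closeP; exists s, u.
have ei : 0 < e^-1 by rewrite invr_gt0.
have t0 := normr_ge0 t.
have de : (e^-1 + `|t|)^-1 <= e.
  by rewrite -[leRHS]invrK lef_pV2 ?posrE//; lra.
split; [exact: lt_le_trans de|exact: lt_le_trans de|] => x xe.
apply: iff_trans (translateE _ _ _) _; apply: iff_trans _ (iff_sym (translateE _ _ _)).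
rewrite ![x + _ + t]addrAC; apply: H; rewrite invrK.
by apply: le_lt_trans (ler_normD _ _) _; rewrite ltrD2r.
Qed.

End DeloneSets.

Record delone (R : realType) := Delone {
  delone_set :> set R;
  deloneP : is_delone delone_set
}.

Lemma delone_inj (R : realType) (L1 L2 : delone R) :
  delone_set L1 = delone_set L2 -> L1 = L2.
Proof.
by case: L1 L2 => [A dA] [B dB] /= AB; subst B; congr Delone; exact: Prop_irrelevance.
Qed.

HB.instance Definition _ (R : realType) := gen_eqMixin (delone R).
HB.instance Definition _ (R : realType) := gen_choiceMixin (delone R).

Section DeloneMetric.
Context {R : realType}.

Let dist (L1 L2 : delone R) : R := pattern_dist L1 L2.

Let distxx L : dist L L = 0. Proof. exact: pattern_distxx. Qed.

Let dist_positivity L1 L2 : dist L1 L2 = 0 -> L1 = L2.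
Proof.
by move=> d0; apply/delone_inj/pattern_dist_positivity => //; exact: deloneP.
Qed.

Let dist_sym L1 L2 : dist L1 L2 = dist L2 L1.
Proof. exact: pattern_dist_sym. Qed.

Let dist_triangle L2 L1 L3 : dist L1 L3 <= dist L1 L2 + dist L2 L3.
Proof. by apply: pattern_dist_triangle; exact: deloneP. Qed.

HB.instance Definition _ :=
  isMetric.Build R (delone R) distxx dist_positivity dist_sym dist_triangle.

End DeloneMetric.

Section PatternSpace.
Context {R : realType}.
Implicit Types L : delone R.

Definition delone_translate (t : R) L : delone R :=
  Delone (is_delone_translate t (deloneP L)).

(* The closure is taken among all Delone sets; this loses nothing, since any set
   at distance 0 from the orbit is locally a translate of L, hence Delone. *)
Definition hull L : set (delone R) :=
  closure [set delone_translate t L | t in [set: R]].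

Definition pattern_space L : Type := set_type (hull L).

Lemma hull_base L : L \in hull L.
Proof.
apply/mem_set; apply: subset_closure; exists 0 => //.
by apply: delone_inj; exact: translate0.
Qed.

Lemma ball_deloneE (L : delone R) (e : R) :
  ball L e = [set L' : delone R | pattern_dist L L' < e].
Proof. by []. Qed.

Lemma continuous_delone_translate t : continuous (delone_translate t).
Proof.
move=> L; apply/(@cvg_ballP R _ _ _ (nbhs_filter L)) => e e0.
pose c : R := (Num.sqrt 2)^-1.
pose d := Num.min ((e / 2)^-1 + `|t|)^-1 c.
have e20 : 0 < e / 2 by rewrite divr_gt0.
have d0 : 0 < d.
  rewrite lt_min sqrt2V_gt0 andbT invr_gt0 ltr_wpDr// invr_gt0//.
near=> L'.
rewrite ball_deloneE /=; apply: (@le_lt_trans _ _ (e / 2)); last by lra.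
apply: pattern_dist_le => //; apply: e_close_translate => //.
apply: (@e_close_mono _ d) => //; first by rewrite ge_min lexx.
apply: pattern_dist_lt; [exact: deloneP|exact: deloneP| |].
  by rewrite ge_min lexx orbT.
by near: L'; exact: (@nbhsx_ballx _ _ L d).
Unshelve. all: by end_near. Qed.

Lemma hull_translate L t L' : L' \in hull L -> delone_translate t L' \in hull L.
Proof.
move=> /set_mem cL'; apply/mem_set => U nU.
have [_ [[s _ <-] Us]] := cL' _ (continuous_delone_translate nU).
exists (delone_translate t (delone_translate s L)); split=> //.
by exists (t + s) => //; apply: delone_inj; rewrite /= translateD.
Qed.

Definition flow L (t : R) (x : pattern_space L) : pattern_space L :=
  exist _ (delone_translate t (val x)) (hull_translate t (valP x)).



HB.instance Definition _ L :=
  PseudoMetric.copy (pattern_space L) (set_type (hull L)).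

HB.instance Definition _ L :=
  isPointed.Build (pattern_space L) (exist _ L (hull_base L)).

(* Borel sigma-algebra *)
HB.instance Definition _ L :=
  @isMeasurable.Build (sigma_display (@open (pattern_space L)))
    (pattern_space L) <<s @open (pattern_space L) >>
    (@sigma_algebra0 _ setT _) (@sigma_algebraC _ _)
    (@sigma_algebra_bigcup _ setT _).

End PatternSpace.

Section Gradient.
Context {R : realType} {L0 : delone R}.
Local Notation Omega := (pattern_space L0).
Implicit Types (f g : Omega -> R) (x : Omega).

Definition diff_quotient f x (s : R) : R := (f (flow s x) - f x) / s.

Definition flow_derivable f x : Prop := cvg (diff_quotient f x @ 0^').

Definition flow_derive f : Omega -> R := fun x => lim (diff_quotient f x @ 0^').

Definition Cinfty f : Prop :=
  forall n, continuous (iter n flow_derive f) /\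
            forall x, flow_derivable (iter n flow_derive f) x.

Definition invariant_measure (mu : probability Omega R) : Prop :=
  forall (t : R) (A : set Omega), measurable A -> mu (flow t @^-1` A) = mu A.

Definition uniquely_ergodic (mu : probability Omega R) : Prop :=
  invariant_measure mu /\
  forall nu : probability Omega R, invariant_measure nu ->
    forall A : set Omega, measurable A -> nu A = mu A.

Variable mu : probability Omega R.

Definition weak_derivative f f' : Prop :=
  forall psi, Cinfty psi ->
    \int[mu]_x (f' x * psi x) = - \int[mu]_x (f x * flow_derive psi x).

(* Vector fields are concrete functions with values in the tangent space R^1;
   L^2 classes appear through the relation [vf_eq], and all the subspaces of
   L^2 below are sets of representatives stable under it. *)
Local Notation vector_field := (Omega -> 'rV[R]_1).
Implicit Types (v w : vector_field) (V W : set vector_field).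

Definition e1 : 'rV[R]_1 := const_mx 1.

Definition dotv (a b : 'rV[R]_1) : R := (a *m b^T) 0 0.

Definition square_integrable : set vector_field :=
  [set (fun x => g x *: e1) | g in [set g | g \in Lfun mu 2%:E]].

Definition inner v w : R := \int[mu]_x dotv (v x) (w x).

Definition vf_eq v w : Prop := {ae mu, forall x, v x = w x}.

(* f is in W^{1,2} and v represents its gradient *)
Definition is_gradient f v : Prop :=
  f \in Lfun mu 2%:E /\
  exists f', [/\ f' \in Lfun mu 2%:E, weak_derivative f f' &
                 v = fun x => f' x *: e1].

Definition im_gradient : set vector_field := [set v | exists f, is_gradient f v].

Definition orth_compl V : set vector_field :=
  [set w | square_integrable w /\ forall v, V v -> inner v w = 0].

(* Needed because the range of the gradient is not a closed subspace of L^2. *)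
Definition L2_closure V : set vector_field :=
  [set v | square_integrable v /\
    forall e : R, 0 < e ->
      exists2 u, V u & Num.sqrt (inner (v \- u) (v \- u)) < e].

Definition L2_classes V : set vector_field :=
  [set v | square_integrable v /\ exists2 u, V u & vf_eq v u].

(* L^2 is the internal orthogonal (hence direct) sum of V and W *)
Definition orthogonal_decomposition V W : Prop :=
  [/\ V `<=` square_integrable, W `<=` square_integrable,
      (forall v w, V v -> W w -> inner v w = 0) &
      forall u, square_integrable u ->
        exists v w, [/\ V v, W w & vf_eq u (v \+ w)]].

Definition one_dimensional V : Prop :=
  exists w, [/\ V w, ~ vf_eq w (cst 0) &
    V = L2_classes [set c *: w | c in [set: R]]].

(* Square integrable 1-forms are identified with square integrable vector
   fields, [f (x) 1] corresponding to the gradient of [f]; [omega] is a field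
   of length 1 almost everywhere. *)
Definition hodge_star (omega : vector_field) f : vector_field :=
  fun x => f x *: omega x.

Definition star : (Omega -> R) -> vector_field := hodge_star (cst e1).

End Gradient.

(* Main.v *)
Require Import Defs.
From HB Require Import structures.
From mathcomp Require Import all_boot all_order all_algebra.
From mathcomp Require Import all_classical all_reals all_analysis.
From mathcomp Require Import measurable_realfun.
From mathcomp Require Import ring lra.

(** Through [star] the vector fields are square integrable functions, and the
    range of the gradient becomes the space [W] of the weak derivatives along the
    flow.  As [L^2] is complete ([L2_complete]), projecting onto the closure of
    [W] ([orthogonal_projection]) gives the decomposition.  What remains is to
    show that the orthogonal complement of [W] consists of the functions that are
    constant almost everywhere.

    Constants are orthogonal to [W]: test the weak derivative against a constant.

    Conversely let [g] be orthogonal to [W].  The weak derivative is the negative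
    adjoint of the derivative on smooth functions, and the complement of the range
    of an adjoint is the kernel of the closure of the original operator.
    Concretely, project [(g, 0)] in [L^2 x L^2] onto the closure of the graph of
    the smooth derivative: the orthogonal component [(c, d)] satisfies the
    equation saying that [c] is the weak derivative of [d], hence [g] is
    orthogonal to [c], and this forces [(c, d)] to be null.  So there are smooth
    [psi] close to [g] whose derivatives are close to [0]
    ([Cinfty_approximation]).

    A mean value inequality in [L^2] ([norm2_increment_le]) bounds the increment
    of [psi] under the flow at time [t] by [`|t|] times the norm of its
    derivative; passing to the limit, [g] is invariant almost everywhere under
    each time [t] of the flow ([gradient_orthogonal_flow_invariant]).  Finally
    the set where [g] exceeds its mean is invariant up to a null set, and if it
    had positive measure then conditioning [mu] on it would give an invariant
    probability measure, hence [mu] itself by unique ergodicity, so that [g] would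
    exceed its mean almost everywhere, which is absurd; the same holds for [- g]
    ([ae_invariant_set_full], [ae_constant]).

    Smooth functions must be square integrable for all this to make sense.  They
    are bounded because finite local complexity makes the pattern space compact
    ([pattern_space_compact]): along an ultrafilter the patches of a given radius
    eventually have a constant shape, and their positions converge. *)

Import Order.TTheory GRing.Theory Num.Theory.
Import numFieldNormedType.Exports.

Local Open Scope classical_set_scope.
Local Open Scope ring_scope.

Set Implicit Arguments.
Unset Strict Implicit.

(** * Orthogonal projection in a semi-inner product space *)

Section RealLemmas.
Context {R : realType}.

(** The usual discriminant argument: evaluate at the vertex [t = b / c], or, when
    [c = 0], at a [t] that makes the affine function equal to [- 1]. *)
Lemma quadratic_discr_le (a b c : R) : 0 <= c ->
  (forall t, 0 <= a - 2 * t * b + t ^+ 2 * c) -> b ^+ 2 <= a * c.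
Proof.
rewrite le_eqVlt => /predU1P[<-{c}|c0] key.
  have [->|b0] := eqVneq b 0; first by rewrite expr0n mulr0.
  have := key ((a + 1) / (2 * b)).
  have -> : a - 2 * ((a + 1) / (2 * b)) * b + ((a + 1) / (2 * b)) ^+ 2 * 0 = -1.
    by field.
  by rewrite ler0N1.
have := key (b / c).
have -> : a - 2 * (b / c) * b + (b / c) ^+ 2 * c = (a * c - b ^+ 2) / c.
  by field; rewrite gt_eqF.
by rewrite pmulr_lge0 ?invr_gt0// subr_ge0.
Qed.

Lemma geometric_small (C e : R) : 0 < e -> exists n, C * 4^-1 ^+ n < e.
Proof.
move=> e0; have : (C * 4^-1 ^+ n) @[n --> \oo] --> 0.
  have := @cvg_geometric R C (4^-1); apply.
  by rewrite ger0_norm ?invr_ge0// invf_lt1// ltr1n.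
move/cvgr_lt => /(_ _ e0)[N _ H]; exists N; apply: H => /=; exact: leqnn.
Qed.

End RealLemmas.

Section SemiInnerProduct.
Context {R : realType} {E : lmodType R}.
Implicit Types (D V : set E) (B : E -> E -> R).

Definition linear_set D : Prop :=
  D 0 /\ forall (a : R) x y, D x -> D y -> D (a *: x + y).

(** Square integrable functions are not given as elements of a quotient space,
    so subspaces are predicates on an ambient module and the form is only
    semidefinite; [D] is the domain on which it is bilinear. *)
Definition semi_inner D B : Prop :=
  [/\ linear_set D, (forall x y, B x y = B y x), (forall x, 0 <= B x x) &
      forall (a : R) x y z, D x -> D y -> D z ->
        B (a *: x + y) z = a * B x z + B y z].

(** Completeness for sequences whose increments decay geometrically.  Every Cauchy
    sequence has such a subsequence, and the minimising sequences of a projection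
    can be chosen of this kind.  The constant [C] makes the property pass to
    products. *)
Definition geometrically_complete D B : Prop :=
  forall u : nat -> E, (forall n, D (u n)) ->
    (forall n m, (n <= m)%N -> B (u m - u n) (u m - u n) <= 4^-1 ^+ n) ->
    exists v C, D v /\ forall n, B (v - u n) (v - u n) <= C * 4^-1 ^+ n.

Definition semi_norm B x : R := Num.sqrt (B x x).

Context {D : set E} {B : E -> E -> R}.
Hypothesis BD : semi_inner D B.

Lemma linear_setB V x y : linear_set V -> V x -> V y -> V (x - y).
Proof.
move=> [_ H] Vx Vy; rewrite addrC -scaleN1r.
exact: H.
Qed.

Lemma linear_setZ V a x : linear_set V -> V x -> V (a *: x).
Proof. by move=> [V0 H] Vx; rewrite -[_ *: _]addr0; exact: H. Qed.

Lemma linear_setD V x y : linear_set V -> V x -> V y -> V (x + y).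
Proof. by move=> [_ H] Vx Vy; rewrite -[x]scale1r; exact: H. Qed.

Let DL : linear_set D. Proof. by case: BD. Qed.

Lemma semi_innerBl x y z : D x -> D y -> D z -> B (x - y) z = B x z - B y z.
Proof.
case: BD => _ _ _ H Dx Dy Dz.
by rewrite addrC -scaleN1r H// mulN1r addrC.
Qed.

Lemma semi_innerBr x y z : D x -> D y -> D z -> B z (x - y) = B z x - B z y.
Proof. by case: BD => _ C _ _ *; rewrite C semi_innerBl// !(C z). Qed.

Lemma semi_innerZl a x z : D x -> D z -> B (a *: x) z = a * B x z.
Proof.
case: BD => -[D0 _] _ _ H Dx Dz; rewrite -[a *: x]addr0 H//.
by have := semi_innerBl D0 D0 Dz; rewrite !subrr => ->; rewrite addr0.
Qed.

Lemma semi_innerDl x y z : D x -> D y -> D z -> B (x + y) z = B x z + B y z.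
Proof.
by case: BD => _ _ _ H Dx Dy Dz; rewrite -{1}[x]scale1r H// mul1r.
Qed.

Lemma semi_innerDr x y z : D x -> D y -> D z -> B z (x + y) = B z x + B z y.
Proof. by case: BD => _ C _ _ *; rewrite C semi_innerDl// !(C z). Qed.

Lemma semi_inner_sqB x y : D x -> D y ->
  B (x - y) (x - y) = B x x - 2 * B x y + B y y.
Proof.
move=> Dx Dy; have Dxy := linear_setB DL Dx Dy.
case: BD => _ C _ _.
by rewrite semi_innerBl// !semi_innerBr// (C y x); ring.
Qed.

Lemma semi_inner_sqZ a x : D x -> B (a *: x) (a *: x) = a ^+ 2 * B x x.
Proof.
move=> Dx; have Dax : D (a *: x) by exact: linear_setZ.
case: BD => _ C _ _.
by rewrite semi_innerZl// C semi_innerZl//; ring.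
Qed.

Lemma semi_cauchy_schwarz x y : D x -> D y -> B x y ^+ 2 <= B x x * B y y.
Proof.
move=> Dx Dy; have [_ C P _] := BD.
have key (t : R) : 0 <= B x x - 2 * t * B x y + t ^+ 2 * B y y.
  have Dty : D (t *: y) by exact: linear_setZ.
  have := P (x - t *: y); rewrite semi_inner_sqB// semi_inner_sqZ//.
  by rewrite (C x) semi_innerZl// (C y x) mulrA.
exact: quadratic_discr_le.
Qed.

Lemma semi_norm_ge0 x : 0 <= semi_norm B x.
Proof. exact: sqrtr_ge0. Qed.

Lemma semi_norm_sq x : semi_norm B x ^+ 2 = B x x.
Proof. by case: BD => _ _ P _; rewrite sqr_sqrtr. Qed.

Lemma semi_inner_le x y : D x -> D y -> `|B x y| <= semi_norm B x * semi_norm B y.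
Proof.
move=> Dx Dy; rewrite -sqrtrM; last by case: BD.
by rewrite -sqrtr_sqr ler_wsqrtr// semi_cauchy_schwarz.
Qed.

Lemma semi_norm_triangle x y : D x -> D y ->
  semi_norm B (x + y) <= semi_norm B x + semi_norm B y.
Proof.
move=> Dx Dy; have [_ C P _] := BD.
have xy0 : 0 <= semi_norm B x + semi_norm B y by rewrite addr_ge0 ?semi_norm_ge0.
rewrite -(@ler_pXn2r _ 2) ?nnegrE ?semi_norm_ge0// semi_norm_sq.
have Dxy := linear_setD DL Dx Dy.
rewrite semi_innerDl// !semi_innerDr// sqrrD !semi_norm_sq (C y x).
have := semi_inner_le Dx Dy; rewrite ler_norml => /andP[_].
lra.
Qed.

Lemma semi_norm_N x : D x -> semi_norm B (- x) = semi_norm B x.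
Proof.
by move=> Dx; rewrite /semi_norm -scaleN1r semi_inner_sqZ// sqrrN expr1n mul1r.
Qed.

(** Cauchy-Schwarz: orthogonality to [V] passes to limits of elements of [V]. *)
Lemma orthogonal_closure V z v : V `<=` D -> D z -> D v ->
  (forall w, V w -> B z w = 0) ->
  (forall e : R, 0 < e -> exists2 w, V w & B (v - w) (v - w) < e) ->
  B z v = 0.
Proof.
move=> VD Dz Dv zV close; have [_ C P _] := BD.
apply/eqP; rewrite -sqrf_eq0 eq_le sqr_ge0 andbT leNgt; apply/negP => pos.
have z1 : 0 < B z z + 1 by rewrite ltr_wpDl.
have [w Vw Hw] := close (B z v ^+ 2 / (B z z + 1)) (divr_gt0 pos z1).
have Dw := VD _ Vw; have Dvw : D (v - w) by exact: linear_setB.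
have := semi_cauchy_schwarz Dz Dvw; rewrite semi_innerBr// (zV w)// subr0.
apply/negP; rewrite -ltNge; move: Hw; rewrite ltr_pdivlMr//; apply: le_lt_trans.
by rewrite mulrC ler_wpM2l// lerDl.
Qed.

(** Hilbert's projection theorem.  By the parallelogram identity a minimising
    sequence [w] for the distance [d] from [u] to [V] has geometrically decaying
    increments, so it has a limit [v]; the almost minimal vectors [u - w n] are
    almost orthogonal to [V], hence [u - v] is orthogonal to it. *)
Lemma orthogonal_projection V u :
  geometrically_complete D B -> V `<=` D -> linear_set V -> D u ->
  exists v, [/\ D v,
    (forall e : R, 0 < e -> exists2 w, V w & B (v - w) (v - w) < e) &
    (forall w, V w -> B (u - v) w = 0)].
Proof.
move=> cD VD VL Du; have [_ C P _] := BD.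
pose S := [set B (u - w) (u - w) | w in V].
have S0 : S !=set0 by exists (B (u - 0) (u - 0)), 0 => //; case: VL.
have Sl : has_lbound S by exists 0 => _ [w _ <-].
pose d := inf S.
have dle w : V w -> d <= B (u - w) (u - w).
  by move=> Vw; apply: ge_inf => //; exists w.
(* the parallelogram identity gives increments bounded by [4 * ep n] *)
pose ep n : R := 4^-1 * 4^-1 ^+ n.
have ep0 n : 0 < ep n by rewrite /ep mulr_gt0// exprn_gt0.
have /choice[w Hw] : forall n, exists w, V w /\ B (u - w) (u - w) < d + ep n.
  move=> n; have /inf_lt[] : inf S < d + ep n by rewrite ltrDl.
    by [].
  by move=> _ [w Vw <-] H; exists w.
have Vw n : V (w n) by case: (Hw n).
have Dw n : D (w n) by exact/VD/Vw.
have close n m : (n <= m)%N -> B (w m - w n) (w m - w n) <= 4^-1 ^+ n.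
  move=> nm; pose x := u - w n; pose y := u - w m.
  have Dx : D x by exact: linear_setB.
  have Dy : D y by exact: linear_setB.
  have -> : w m - w n = x - y by rewrite /x /y opprB [RHS]addrC addrA subrK.
  have Vz : V (2^-1 *: (w n + w m)).
    by apply: linear_setZ => //; exact: linear_setD.
  (* parallelogram identity: the midpoint of [w n] and [w m] is at distance at
     least [d] from [u] *)
  have := (Hw n).2; have := (Hw m).2; have := dle _ Vz; rewrite -/x -/y.
  have -> : u - 2^-1 *: (w n + w m) = 2^-1 *: (x - (- 1) *: y).
    rewrite scaleN1r opprK /x /y addrACA -opprD scalerBr -[u in u + u]scale1r.
    by rewrite -scalerDl scalerA mulVf ?scale1r.
  clearbody x y.
  rewrite semi_inner_sqZ; last by apply: linear_setB => //; exact: linear_setZ.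
  rewrite !semi_inner_sqB//; last exact: linear_setZ.
  rewrite semi_inner_sqZ// (C x (_ *: _)) semi_innerZl// (C y x).
  have epmn : ep m <= ep n.
    by rewrite /ep ler_pM2l//; apply: ler_wiXn2l => //; lra.
  rewrite /ep in epmn *; set q := 4^-1 ^+ n in epmn *.
  lra.
have [v [K [Dv Hv]]] := cD w Dw close.
exists v; split=> //.
  move=> e e0; have [n Hn] := geometric_small K e0.
  by exists (w n); [exact: Vw|exact: le_lt_trans (Hv n) Hn].
move=> z Vz; have Dz := VD _ Vz.
have Duw n : D (u - w n) by exact: linear_setB.
(* [u - w n] is almost minimal, and moving it along [z] cannot beat [d] *)
have almost n : B (u - w n) z ^+ 2 <= ep n * B z z.
  apply: quadratic_discr_le => // t.
  have Dtz : D (t *: z) by exact: linear_setZ.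
  have /dle : V (w n + t *: z) by apply: linear_setD => //; exact: linear_setZ.
  rewrite opprD addrA semi_inner_sqB// semi_inner_sqZ//.
  rewrite (C (u - w n) (t *: z)) semi_innerZl// (C z).
  by have := (Hw n).2; lra.
have limit n : B (v - w n) z ^+ 2 <= K * 4^-1 ^+ n * B z z.
  apply: le_trans (semi_cauchy_schwarz _ Dz) _; first exact: linear_setB.
  exact: ler_wpM2r.
apply/eqP; rewrite -sqrf_eq0 eq_le sqr_ge0 andbT leNgt; apply/negP => pos.
have [n] := geometric_small ((2 * K + 1) * B z z) pos.
apply/negP; rewrite -leNgt.
have -> : u - v = (u - w n) - (v - w n) by rewrite opprB subrKA.
rewrite semi_innerBl//; last exact: linear_setB.
have := almost n; have := limit n; rewrite /ep.
set p := B (u - w n) z; set q := B (v - w n) z => Hq Hp.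
have := sqr_ge0 (p + q); rewrite sqrrD sqrrB.
have : 0 <= 4^-1 ^+ n * B z z by rewrite mulr_ge0// exprn_ge0.
lra.
Qed.

End SemiInnerProduct.

Section ProductSpace.
Context {R : realType} {E1 E2 : lmodType R}.

Definition prod_inner (B1 : E1 -> E1 -> R) (B2 : E2 -> E2 -> R)
  (x y : (E1 * E2)%type) : R := B1 x.1 y.1 + B2 x.2 y.2.

Context {D1 : set E1} {B1 : E1 -> E1 -> R} {D2 : set E2} {B2 : E2 -> E2 -> R}.

Lemma prod_linear_set : linear_set D1 -> linear_set D2 ->
  linear_set (D1 `*` D2).
Proof.
move=> [D10 H1] [D20 H2]; split=> // a x y [Dx1 Dx2] [Dy1 Dy2].
by split; [exact: H1|exact: H2].
Qed.

Lemma prod_semi_inner : semi_inner D1 B1 -> semi_inner D2 B2 ->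
  semi_inner (D1 `*` D2) (prod_inner B1 B2).
Proof.
move=> [L1 C1 P1 H1] [L2 C2 P2 H2]; split.
- exact: prod_linear_set.
- by move=> x y; rewrite /prod_inner C1 C2.
- by move=> x; apply: addr_ge0.
- move=> a x y z [x1 x2] [y1 y2] [z1 z2].
  by rewrite /prod_inner H1// H2//; ring.
Qed.

Lemma prod_geometrically_complete :
  (forall x, 0 <= B1 x x) -> (forall x, 0 <= B2 x x) ->
  geometrically_complete D1 B1 -> geometrically_complete D2 B2 ->
  geometrically_complete (D1 `*` D2) (prod_inner B1 B2).
Proof.
move=> p1 p2 c1 c2 u Du close.
have [||v1 [K1 [Dv1 H1]]] := c1 (fun n => (u n).1).
- by move=> n; case: (Du n).
- by move=> n m /close; apply: le_trans; rewrite lerDl.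
have [||v2 [K2 [Dv2 H2]]] := c2 (fun n => (u n).2).
- by move=> n; case: (Du n).
- by move=> n m /close; apply: le_trans; rewrite lerDr.
exists (v1, v2), (K1 + K2); split=> // n.
by rewrite mulrDl; apply: lerD; [exact: H1|exact: H2].
Qed.

End ProductSpace.

(** * Square integrable functions on a probability space *)

Section SquareIntegrable.
Context {d} {T : measurableType d} {R : realType} (mu : probability T R).
Implicit Types f g : T -> R.

Definition L2 : set (T -> R) := [set f | f \in Lfun mu 2%:E].

Definition L2_inner f g : R := \int[mu]_x (f x * g x).

Lemma L2P f : L2 f <->
  measurable_fun [set: T] f /\ (\int[mu]_x (f x ^+ 2)%:E < +oo)%E.
Proof.
split=> [Lf|[mf lf]].
  split; first by move: Lf; rewrite /L2/= inE => /andP[/[!inE]].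
  have /integrable_lty := Lfun2_integrable_sqr Lf.
  by apply.
rewrite /L2/= inE; apply/andP; split; rewrite inE//=.
rewrite /finite_norm unlock /Lnorm/= poweR_lty//.
by under eq_integral do rewrite powR_mulrn// -normrX ger0_norm ?sqr_ge0//.
Qed.

Lemma L2_measurable f : L2 f -> measurable_fun [set: T] f.
Proof. by case/L2P. Qed.

Lemma L2_mul_integrable f g : L2 f -> L2 g ->
  mu.-integrable [set: T] (EFin \o (fun x => f x * g x)).
Proof. by move=> Lf Lg; apply/Lfun1_integrable; exact: Lfun2_mul_Lfun1. Qed.

Lemma L2_integrable f : L2 f -> mu.-integrable [set: T] (EFin \o f).
Proof.
move=> Lf; apply/Lfun1_integrable; apply: Lfun_subset12 Lf.
exact: fin_num_measure.
Qed.

Lemma L2_cst c : L2 (cst c).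
Proof. exact: Lfun_cst. Qed.

Lemma L2_bounded f (M : R) : measurable_fun [set: T] f ->
  (forall x, `|f x| <= M) -> L2 f.
Proof.
move=> mf fM; apply/L2P; split=> //.
apply: (@le_lt_trans _ _ (\int[mu]_x (cst (M ^+ 2)%:E x))%E).
  apply: ge0_le_integral => //.
  - by move=> x _; rewrite lee_fin sqr_ge0.
  - by apply/measurable_EFinP; exact: measurable_funX.
  - by move=> x _; rewrite lee_fin -real_normK ?num_real// lerXn2r ?nnegrE//;
      exact: le_trans (fM x).
rewrite integral_cst//.
by rewrite lte_mul_pinfty ?lee_fin ?sqr_ge0// -ge0_fin_numE ?fin_num_measure.
Qed.

Lemma L2_linear : linear_set L2.
Proof.
have H : submod_closed (Lfun mu 2%:E).
  by apply: Lfun_submod_closed; rewrite lee1n.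
by case: H => H0 H; split=> // a f g; exact: H.
Qed.

Lemma L2_semi_inner : semi_inner L2 L2_inner.
Proof.
split.
- exact: L2_linear.
- by move=> f g; apply: eq_Rintegral => x _; rewrite mulrC.
- by move=> f; apply: Rintegral_ge0 => x _; rewrite -expr2 sqr_ge0.
- move=> a f g h Lf Lg Lh; rewrite /L2_inner.
  rewrite -RintegralZl//; last exact: L2_mul_integrable.
  rewrite -RintegralD//.
  + by apply: eq_Rintegral => x _; rewrite !fctE -mulr_algl mulr_algl mulrDl mulrA.
  + have Laf : L2 (a *: f) by exact: linear_setZ L2_linear _.
    rewrite (_ : _ \o _ = EFin \o (fun x => (a *: f) x * h x)).
      exact: L2_mul_integrable.
    by apply/funext => x /=; rewrite mulrA.
  + exact: L2_mul_integrable.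
Qed.

Lemma L2_inner_sqE f : L2 f ->
  (L2_inner f f)%:E = (\int[mu]_x (f x ^+ 2)%:E)%E.
Proof.
move=> Lf; rewrite /L2_inner /Rintegral.
under eq_integral do rewrite -expr2.
by rewrite fineK//; apply: integrable_fin_num => //; exact: Lfun2_integrable_sqr.
Qed.

Lemma L2_inner_eq0 f : L2 f -> L2_inner f f = 0 -> {ae mu, forall x, f x = 0}.
Proof.
move=> Lf f0; have mf := L2_measurable Lf.
have : ae_eq mu [set: T] (fun x => (f x ^+ 2)%:E) (cst 0%E).
  apply/ae_eq_integral_abs => //.
    by apply/measurable_EFinP; exact: measurable_funX.
  rewrite -[RHS]/(0%:E) -f0 L2_inner_sqE//.
  by apply: eq_integral => x _; rewrite gee0_abs// lee_fin sqr_ge0.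
apply: filterS => x /(_ I)[] /eqP; rewrite sqrf_eq0 => /eqP; exact.
Qed.

Lemma L2_normr f : L2 f -> L2 (fun x => `|f x|).
Proof.
move=> /L2P[mf lf]; apply/L2P; split; first exact: measurableT_comp.
by under eq_integral do rewrite real_normK ?num_real//.
Qed.

Lemma L1_le_L2 f (c : R) : L2 f -> 0 <= c -> L2_inner f f <= c ^+ 2 ->
  (\int[mu]_x `|f x|%:E <= c%:E)%E.
Proof.
move=> Lf c0 fc; have Laf := L2_normr Lf.
have L1 : L2 (cst 1) := L2_cst 1.
have -> : (\int[mu]_x `|f x|%:E)%E = (L2_inner (fun x => `|f x|) (cst 1))%:E.
  rewrite /L2_inner /Rintegral; under [in RHS]eq_integral do rewrite mulr1.
  by rewrite fineK//; apply: integrable_fin_num => //; exact: L2_integrable.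
rewrite lee_fin -(@ler_pXn2r _ 2) ?nnegrE//; last first.
  by apply: Rintegral_ge0 => x _; rewrite mulr1.
apply: le_trans (semi_cauchy_schwarz L2_semi_inner Laf L1) _.
have -> : L2_inner (cst 1) (cst 1) = 1.
  rewrite /L2_inner; under eq_Rintegral do rewrite mulr1.
  by rewrite Rintegral_cst// mul1r; exact: (congr1 fine (probability_setT mu)).
rewrite mulr1; apply: le_trans fc; rewrite le_eqVlt; apply/orP; left; apply/eqP.
by apply: eq_Rintegral => x _; rewrite -!expr2 real_normK ?num_real.
Qed.

(** By monotone convergence the series of the absolute increments has a finite
    integral, so it is finite almost everywhere, and there the sequence is
    absolutely summable. *)
Lemma ae_cvg_summable_increments (u : nat -> T -> R) :
  (forall n, measurable_fun [set: T] (u n)) ->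
  (\sum_(0 <= n <oo) \int[mu]_x `|u n.+1 x - u n x|%:E < +oo)%E ->
  {ae mu, forall x, cvgn (u ^~ x)}.
Proof.
move=> mu_ sumu.
pose h n x := `|u n.+1 x - u n x|%:E.
have mh n : measurable_fun [set: T] (h n).
  by apply/measurable_EFinP/measurableT_comp => //; exact: measurable_funB.
have h0 n x : (0 <= h n x)%E by rewrite /h lee_fin.
have : mu.-integrable [set: T] (fun x => \sum_(0 <= n <oo) h n x)%E.
  apply/integrableP; split.
    by apply: ge0_emeasurable_sum.
  under eq_integral do rewrite gee0_abs ?nneseries_ge0//.
  by rewrite integral_nneseries.
move=> /(integrable_ae measurableT); apply: filterS => x /(_ I) fx.
have cs : cvgn (series (telescope (u ^~ x))).
  apply: normed_cvg; apply: nondecreasing_is_cvgn.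
    by apply: nondecreasing_series => k _ _; exact: normr_ge0.
  exists (fine (\sum_(0 <= n <oo) h n x)) => _ [n _ <-].
  rewrite -lee_fin fineK// /series/= -sumEFin.
  exact: nneseries_lim_ge.
have -> : u ^~ x = (fun n => u 0%N x + series (telescope (u ^~ x)) n).
  by apply/funext => n; rewrite -(eq_sum_telescope (u ^~ x)).
by apply: is_cvgD => //; exact: is_cvg_cst.
Qed.

Lemma limn_einf_le (v : nat -> \bar R) (c : \bar R) :
  (forall n, (v n <= c)%E) -> (limn_einf v <= c)%E.
Proof.
move=> vc; rewrite limn_einf_lim; apply: lime_le; first exact: is_cvg_einfs.
apply: nearW => n; apply: le_trans (vc n).
by apply: ereal_inf_lbound; exists n => /=.
Qed.

(** Riesz-Fischer.  Geometric decay of the increments in [L^2] gives summability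
    in [L^1], hence a pointwise limit almost everywhere; Fatou's lemma turns the
    bound on [u m - u n] into one on [f - u n]. *)
Lemma L2_complete : geometrically_complete L2 L2_inner.
Proof.
move=> u Lu close; have m_u n := L2_measurable (Lu n).
have LuB n m : L2 (u m - u n) by exact: linear_setB L2_linear _ _.
have cv : {ae mu, forall x, cvgn (u ^~ x)}.
  apply: ae_cvg_summable_increments => //.
  apply: (@le_lt_trans _ _ 2%:E); last exact: ltry.
  apply: le_trans (epsilon_trick0 xpredT (ler0n _ 2)).
  apply: lee_nneseries => n _; first by move=> _; apply: integral_ge0.
  apply: (L1_le_L2 (LuB n n.+1)); first by rewrite divr_ge0.
  apply: le_trans (close _ _ (leqnSn n)) _.
  have -> : 2 / (2 ^ n.+1)%:R = 2^-1 ^+ n :> R.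
    by rewrite natrX exprS invfM mulrA mulfV ?mul1r ?exprVn// pnatr_eq0.
  by rewrite -exprM mulnC exprM (_ : 4^-1 = 2^-1 ^+ 2 :> R)//; field.
(* an upper limit is measurable even where the sequence does not converge *)
pose f x := fine (limn_esup (fun n => (u n x)%:E)).
have mf : measurable_fun [set: T] f.
  apply: measurableT_comp => //.
  by apply: measurable_fun_limn_esup => n; exact/measurable_EFinP.
have uf : {ae mu, forall x, u n x @[n --> \oo] --> f x}.
  apply: filterS cv => x /cvg_ex[l ul].
  have /cvg_limn_einf_sup[_ fl] : (u n x)%:E @[n --> \oo] --> l%:E.
    by apply: cvg_EFin ul; apply: nearW.
  by rewrite /f fl.
have key n : (\int[mu]_x ((f x - u n x) ^+ 2)%:E <= (4^-1 ^+ n)%:E)%E.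
  pose F m x := ((u (m + n)%N x - u n x) ^+ 2)%:E.
  have mF m : measurable_fun [set: T] (F m).
    by apply/measurable_EFinP/measurable_funX; exact: measurable_funB.
  have F0 m x : [set: T] x -> (0 <= F m x)%E by rewrite lee_fin sqr_ge0.
  have -> : (\int[mu]_x ((f x - u n x) ^+ 2)%:E =
             \int[mu]_x limn_einf (F ^~ x))%E.
    apply: ae_eq_integral => //.
    - apply/measurable_EFinP/measurable_funX; exact: measurable_funB.
    - rewrite /limn_einf; apply: measurableT_comp => //.
      by apply: measurable_fun_limn_esup => m; exact: measurableT_comp.
    apply: filterS uf => x ux _; apply/esym.
    have [] // : (limn_einf (F ^~ x) = ((f x - u n x) ^+ 2)%:E) *
      (limn_esup (F ^~ x) = ((f x - u n x) ^+ 2)%:E).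
    apply: cvg_limn_einf_sup; apply: cvg_EFin; first exact: nearW.
    have uxn : u (m + n)%N x - u n x @[m --> \oo] --> f x - u n x.
      by apply: cvgB; [rewrite (cvg_shiftn n (u ^~ x))|exact: cvg_cst].
    rewrite expr2 (_ : _ \o _ = fun m => (u (m + n)%N x - u n x) *
                                          (u (m + n)%N x - u n x)).
      exact: cvgM.
    by apply/funext => m /=; rewrite expr2.
  apply: le_trans (fatou _ _ mF F0) _ => //.
  apply: limn_einf_le => m.
  by have := close _ _ (leq_addl m n); rewrite -lee_fin L2_inner_sqE.
have Lfu n : L2 (f - u n).
  apply/L2P; split; first exact: measurable_funB.
  by apply: le_lt_trans (key n) _; rewrite ltry.
exists f, 1; split; last first.
  by move=> n; rewrite mul1r -lee_fin L2_inner_sqE//; exact: key.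
rewrite -[f](subrK (u 0%N)); exact: linear_setD L2_linear _ _.
Qed.

End SquareIntegrable.

(** * Compactness of the pattern space *)

Section Ultrafilters.
Context {T : Type} {F : set_system T}.
Hypothesis UF : UltraFilter F.

Lemma ultra_bigcup_finite (I : choiceType) (C : set I) (S : I -> set T) :
  finite_set C -> F (\bigcup_(i in C) S i) -> exists2 i, C i & F (S i).
Proof.
move=> /finite_seqP[s ->] {C}; elim: s => [|i s IH].
  by rewrite set_nil bigcup_set0 => /filter_not_empty.
move=> FU; have [FSi|FSi] := in_ultra_setVsetC (S i) UF.
  by exists i => //=; rewrite inE eqxx.
have [|j js FSj] := IH.
  apply: filterS (filterI FSi FU) => x [nSi [j]] /=; rewrite inE.
  by case/predU1P=> [-> /nSi//|js Sj]; exists j.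
by exists j => //=; rewrite inE js orbT.
Qed.

Lemma ultra_bounded_cvg {R : realType} (f : T -> R) (M : R) :
  F [set x | `|f x| <= M] -> exists l : R, f x @[x --> F] --> l.
Proof.
move=> FM; have PF : ProperFilter F := @ultra_proper _ _ UF.
have FI : (fmap f F) `[- M, M]%classic.
  by apply: (@filterS _ F _ _ _ _ FM) => x /=; rewrite in_itv/= -ler_norml.
have [l [_ cl]] := segment_compact (fmap_proper_filter f PF) FI.
exists l => U nU; have [//|FnU] := in_ultra_setVsetC (f @^-1` U) UF.
have [y []] : (~` U) `&` U !=set0 by apply: cl.
by move=> nUy /nUy.
Qed.

End Ultrafilters.

Section HullGeometry.
Context {R : realType} {L0 : delone R}.
Implicit Types (L : delone R) (x y t r e : R).

(** Every element of the hull is a limit of translates of [L0], so on any given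
    ball it coincides exactly with a single translate: closeness allows a small
    shift, which is absorbed in [t]. *)
Lemma hull_local L r : hull L0 L ->
  exists t, forall x, `|x| < r -> (delone_set L x <-> delone_set L0 (x + t)).
Proof.
(* below the truncation [(Num.sqrt 2)^-1] of the metric, small distance means
   closeness; [(`|r| + 1)^-1] makes the radius of agreement exceed [r + e] *)
move=> cL; pose e := Num.min ((`|r| + 1)^-1) ((Num.sqrt 2)^-1 : R).
have r1 : 0 < `|r| + 1 by rewrite ltr_wpDl.
have e0 : 0 < e by rewrite lt_min invr_gt0 r1 sqrt2V_gt0.
have es : e <= (Num.sqrt 2)^-1 by rewrite ge_min lexx orbT.
have e1 : e < 1 := le_lt_trans es (@sqrt2V_lt1 R).
have er : `|r| + 1 <= e^-1.
  by rewrite -[leLHS]invrK lef_pV2 ?posrE ?invr_gt0// ge_min lexx.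
have [_ [[tau _ <-] H]] := cL _ (nbhsx_ballx L e e0).
have /e_closeP[s [t [se te K]]] : e_close e L (translate tau L0).
  by apply: pattern_dist_lt => //; [exact: deloneP|exact/is_delone_translate/deloneP].
exists (t + tau - s) => x xr.
have xs : `|x - s| < e^-1.
  apply: le_lt_trans (ler_normB _ _) _; apply: lt_le_trans er.
  by have := ler_norm r; lra.
have := K _ xs; rewrite subrK => {}K; apply: iff_trans K _.
apply: iff_trans (translateE _ _ _) _.
by have -> : x - s + t + tau = x + (t + tau - s) by ring.
Qed.

Lemma hull_uniformly_discrete :
  exists2 e, 0 < e & forall L, hull L0 L ->
    forall x y, delone_set L x -> delone_set L y -> x != y -> e < `|x - y|.
Proof.
have [[e e0 He] _] := deloneP L0; exists e => // L hL x y Lx Ly xy.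
have [t Ht] := hull_local (`|x| + `|y| + 1) hL.
have nx := normr_ge0 x; have ny := normr_ge0 y.
have -> : x - y = (x + t) - (y + t) by ring.
apply: He; last by apply: contra_neq xy => /addIr.
- by apply/Ht => //; lra.
- by apply/Ht => //; lra.
Qed.

Lemma hull_relatively_dense :
  exists2 r, 0 < r & forall L, hull L0 L ->
    forall x, exists2 y, delone_set L y & `|y - x| < r.
Proof.
have [_ [r r0 Hr]] := deloneP L0; exists r => // L hL x.
have [t Ht] := hull_local (`|x| + r) hL.
have [z [L0z]] := Hr (x + t); rewrite -ball_normE/= => xz.
have zx : `|z - t - x| < r.
  by rewrite (_ : z - t - x = - (x + t - z)) ?normrN//; ring.
exists (z - t) => //; apply/Ht; last by rewrite subrK.
rewrite (_ : z - t = x + (z - t - x)); last by ring.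
by apply: le_lt_trans (ler_normD _ _) _; rewrite ltrD2l.
Qed.

Lemma hull_patches r : finite_local_complexity L0 -> 0 < r ->
  exists C : set (set R), [/\ finite_set C, (forall P, C P -> finite_set P) &
    forall L, hull L0 L -> exists2 P, C P &
      exists t, ball 0 r `&` L = translate t P].
Proof.
move=> flc r0; have [C [fC clC HC]] := flc _ r0.
exists C; split=> //; first by move=> P /clC[].
move=> L hL; have [t Ht] := hull_local r hL.
have [P CP [u Hu]] := HC t; exists P => //; exists (t + u).
rewrite -translateD -Hu; apply/seteqP; split=> x.
  move=> [/in_ball0 xr Lx]; apply/translateE; split; last exact/Ht.
  by rewrite -ball_normE/= opprD addrCA subrr addr0 normrN.
move=> /translateE[]; rewrite -ball_normE/= opprD addrCA subrr addr0 normrN.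
by move=> xr L0x; split; [exact/in_ball0|exact/Ht].
Qed.

End HullGeometry.

Section PatternSpaceCompact.
Context {R : realType} {L0 : delone R}.
Local Notation Omega := (pattern_space L0).
Hypothesis flc : finite_local_complexity L0.
Implicit Types (r e y z u : R).

Let hullP (x : Omega) : hull L0 (val x).
Proof. exact: set_mem (valP x). Qed.

Section UltrafilterLimit.
Context {F : set_system Omega}.
Hypothesis UF : UltraFilter F.

Let PF : ProperFilter F. Proof. exact: ultra_proper. Qed.

(** Finite local complexity enters here: the patches of radius [r + r0] belong,
    up to translation, to finitely many classes, and the ultrafilter selects one
    class [P].  The offset of the patch inside the class is bounded, so it
    converges along the ultrafilter to some [l], and [Q] is the translate of [P]
    by [l]. *)
Lemma ultra_patch r : 0 < r -> exists2 Q : set R, finite_set Q &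
  forall e, 0 < e -> F [set x : Omega | exists2 u, `|u| < e &
    forall y, `|y| < r -> (delone_set (val x) y <-> Q (y + u))].
Proof.
move=> r_gt0; have [r0 r0_gt0 dense] := @hull_relatively_dense _ L0.
have rho_gt0 : 0 < r + r0 by rewrite addr_gt0.
have [C [fC fP HC]] := hull_patches flc rho_gt0.
pose shift (P : set R) (x : Omega) :=
  [set t | ball 0 (r + r0) `&` val x = translate t P].
have [P CP FP] : exists2 P, C P & F [set x | shift P x !=set0].
  apply: ultra_bigcup_finite => //; apply: filterS filterT => x _.
  by have [P CP [t Ht]] := HC _ (@hullP x); exists P => //; exists t.
have shiftE x t y : shift P x t -> `|y| < r + r0 -> (delone_set (val x) y <-> P (y + t)).
  move=> Ht yr; have := congr1 (fun A : set R => A y) Ht; rewrite /setI/= => E.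
  split=> [xy|Py]; first by apply/translateE; rewrite -E; split=> //; exact/in_ball0.
  by have /translateE := Py; rewrite -E => -[].
have shift_ball x t p : shift P x t -> P p -> `|p - t| < r + r0.
  move=> Ht Pp; have : translate t P (p - t) by apply/translateE; rewrite subrK.
  by rewrite -Ht => -[/in_ball0].
(* the radius [r + r0] exceeds the covering radius, so [P] has a point *)
have [p Pp] : P !=set0.
  have [x [t Ht]] := filter_ex FP.
  have [y xy] := dense _ (@hullP x) 0; rewrite subr0 => yr.
  by exists (y + t); apply/(shiftE x) => //; rewrite ltr_wpDl// ltW.
pose tau x := xget 0 (shift P x).
have Ftau : F [set x | shift P x (tau x)].
  by apply: filterS FP => x [t Ht]; exact: (xgetPex 0 (ex_intro _ t Ht)).
have [l tl] : exists l : R, tau x @[x --> F] --> l.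
  apply: (@ultra_bounded_cvg _ _ _ _ _ (`|p| + (r + r0))) => //.
  apply: filterS Ftau => x /shift_ball /(_ Pp) pt /=.
  rewrite (_ : tau x = p - (p - tau x)); last by ring.
  by apply: le_trans (ler_normB _ _) _; rewrite lerD2l ltW.
exists (translate l P); first by apply: finite_image; exact: fP.
move=> e e0; have Fl : F [set x | `|l - tau x| < e].
  by have /cvgrPdist_lt /(_ e e0) := tl.
apply: filterS (filterI Ftau Fl) => x [xt xl] /=.
exists (tau x - l); first by rewrite distrC.
move=> y yr; have yr' : `|y| < r + r0 by rewrite ltr_wpDr// ltW.
apply: iff_trans (shiftE _ _ _ xt yr') _; rewrite addrA.
by apply: iff_sym; apply: iff_trans (translateE _ _ _) _; rewrite subrK.
Qed.

(** The set of limits of points of the patterns along the ultrafilter.  It has to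
    be defined for all radii at once, since the patches [Q] of [ultra_patch] come
    with no relation between different radii. *)
Definition ultra_limit : set R :=
  [set y | forall e, 0 < e ->
    F [set x : Omega | exists2 z, delone_set (val x) z & `|z - y| < e]].

(** On the ball of radius [r + 1] the limit set is the patch [Q] of
    [ultra_patch]; the margin [1] absorbs the shift [u]. *)
Lemma ultra_limitP r e : 0 < r -> 0 < e ->
  F [set x : Omega | exists2 u, `|u| < e &
    forall y, `|y| < r -> (delone_set (val x) y <-> ultra_limit (y + u))].
Proof.
move=> r0 e0; have rho0 : 0 < r + 1 by rewrite addr_gt0.
have [Q fQ HQ] := ultra_patch rho0.
have limitE z : `|z| < r + 1 -> (Q z <-> ultra_limit z).
  move=> zr; split=> [Qz d d0|Lz].
    have d'0 : 0 < Num.min d (r + 1 - `|z|) by rewrite lt_min d0 subr_gt0.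
    apply: filterS (HQ _ d'0) => x [u]; rewrite lt_min => /andP[ud uz] Hu.
    exists (z - u); last by rewrite addrAC subrr add0r normrN.
    apply/Hu; last by rewrite subrK.
    by apply: le_lt_trans (ler_normB _ _) _; rewrite -ltrBrDl.
  apply: contrapT => nQz.
  have : open (~` Q).
    apply: closed_openC; apply: (accessible_finite_set_closed.1 _ _ fQ).
    exact/hausdorff_accessible/norm_hausdorff.
  rewrite openE => /(_ _ nQz) /nbhs_ballP[eta /= eta0 Heta].
  have eta20 : 0 < eta / 2 by rewrite divr_gt0.
  have d0 : 0 < Num.min (eta / 2) (r + 1 - `|z|) by rewrite lt_min eta20 subr_gt0.
  have [x [[u ueta Hu] [y xy]]] := filter_ex (filterI (HQ _ eta20) (Lz _ d0)).
  rewrite lt_min => /andP[yeta yz].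
  have yr : `|y| < r + 1.
    rewrite (_ : y = z + (y - z)); last by ring.
    by apply: le_lt_trans (ler_normD _ _) _; rewrite -ltrBrDl.
  have Qyu : Q (y + u) by apply/Hu.
  apply: (Heta (y + u)) => //; rewrite -ball_normE/= distrC addrAC.
  by apply: le_lt_trans (ler_normD _ _) _; lra.
have e'0 : 0 < Num.min e 1 by rewrite lt_min e0/=.
apply: filterS (HQ _ e'0) => x [u]; rewrite lt_min => /andP[ue u1] Hu.
exists u => // y yr; apply: iff_trans (Hu _ _) _; first by lra.
by apply: limitE; apply: le_lt_trans (ler_normD _ _) _; exact: ltrD.
Qed.

(** On every ball the limit set is a small shift of a pattern of the hull, and
    these patterns share their packing and covering constants. *)
Lemma ultra_limit_delone : is_delone ultra_limit.
Proof.
have near r : 0 < r -> exists x : Omega, exists2 u, `|u| < 1 &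
    forall y, `|y| < r -> (ultra_limit y <-> delone_set (val x) (y - u)).
  move=> r0; have r10 : 0 < r + 1 by rewrite addr_gt0.
  have [x [u u1 Hu]] := filter_ex (ultra_limitP r10 ltr01).
  exists x, u => // y yr; rewrite -{1}[y](subrK u); apply: iff_sym; apply: Hu.
  by apply: le_lt_trans (ler_normB _ _) _; exact: ltrD.
split.
  have [e e0 He] := @hull_uniformly_discrete _ L0; exists e => // x y Lx Ly xy.
  have nx := normr_ge0 x; have ny := normr_ge0 y.
  have r0 : 0 < `|x| + `|y| + 1 by lra.
  have [w [u _ Hu]] := near _ r0.
  have -> : x - y = (x - u) - (y - u) by ring.
  apply: (He _ (@hullP w)); last by apply: contra_neq xy => /addIr.
  - by apply/Hu => //; lra.
  - by apply/Hu => //; lra.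
have [r r0 Hr] := @hull_relatively_dense _ L0.
exists (r + 1) => [|x]; first by rewrite addr_gt0.
have nx := normr_ge0 x.
have rho0 : 0 < `|x| + r + 1 by lra.
have [w [u u1 Hu]] := near _ rho0.
have [z wz zx] := Hr _ (@hullP w) x.
have zxu : `|z + u - x| < r + 1.
  by rewrite addrAC; apply: le_lt_trans (ler_normD _ _) _; exact: ltrD.
exists (z + u); split; last by rewrite -ball_normE/= distrC.
apply/Hu; last by rewrite addrK.
rewrite (_ : z + u = x + (z + u - x)); last by ring.
by apply: le_lt_trans (ler_normD _ _) _; lra.
Qed.

End UltrafilterLimit.

(** Agreement on a large ball after a small shift is closeness for the pattern
    metric, so [ultra_limitP] says that the ultrafilter converges. *)
Lemma pattern_space_compact : compact [set: Omega].
Proof.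
rewrite compact_ultra => F UF _.
have PF : ProperFilter F := @ultra_proper _ _ UF.
pose L := Delone (ultra_limit_delone UF).
have FL e : 0 < e -> F [set x : Omega | pattern_dist L (val x) < e].
  move=> e0; have e20 : 0 < e / 2 by rewrite divr_gt0.
  have ie : 0 < (e / 2)^-1 by rewrite invr_gt0.
  apply: filterS (ultra_limitP UF ie e20) => x [u ue Hu] /=.
  apply: (@le_lt_trans _ _ (e / 2)); last by lra.
  apply: pattern_dist_le => //; apply/e_closeP; exists u, 0; split=> //.
    by rewrite normr0.
  by move=> y /Hu xy; rewrite addr0; exact: iff_sym.
have hL : hull L0 L.
  rewrite /hull; apply: closed_closure.
  move=> U /nbhs_ballP[e /= e0 LU].
  have [x xe] := filter_ex (FL _ e0).
  by exists (val x); split; [exact: hullP|exact: LU].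
exists (exist _ L (mem_set hL)); split=> //.
by apply/cvg_ballP => e e0; exact: FL.
Qed.

(** What compactness is for: smooth functions and their derivatives are bounded,
    hence square integrable. *)
Lemma continuous_bounded (f : Omega -> R) : continuous f ->
  exists2 M : R, 0 < M & forall x, `|f x| <= M.
Proof.
move=> cf; have /compact_bounded[M [_ HM]] :=
  continuous_compact (continuous_subspaceT cf) pattern_space_compact.
exists (`|M| + 1); first by rewrite ltr_wpDl.
move=> x; apply: (HM (`|M| + 1)); last by exists x.
by apply: le_lt_trans (ler_norm M) _; rewrite ltrDl.
Qed.

End PatternSpaceCompact.

(** * The translation flow and derivatives along it *)

Section FlowTopology.
Context {R : realType} {L0 : delone R}.
Local Notation Omega := (pattern_space L0).
Implicit Types (x : Omega) (s t : R) (f : Omega -> R).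

Lemma flowD s t x : flow s (flow t x) = flow (s + t) x.
Proof. by apply/val_inj/delone_inj; rewrite /= translateD. Qed.

Lemma flow0 x : flow 0 x = x.
Proof. by apply/val_inj/delone_inj; rewrite /= translate0. Qed.

Lemma continuous_flow t : continuous (flow t : Omega -> Omega).
Proof.
apply: continuous_comp_initial => x.
have vc : {for x, continuous (set_val : Omega -> delone R)}.
  exact: initial_continuous.
exact: (continuous_comp vc (@continuous_delone_translate _ t _)).
Qed.

Lemma open_measurable_pattern (U : set Omega) : open U -> measurable U.
Proof. exact: sub_sigma_algebra. Qed.

Lemma measurable_flow t : measurable_fun [set: Omega] (flow t : Omega -> Omega).
Proof.
apply: (measurability (@open Omega)) => // _ [U oU <-]; rewrite setTI.
apply: open_measurable_pattern.
by move/continuousP : (@continuous_flow t); exact.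
Qed.

Lemma continuous_measurable_pattern f : continuous f ->
  measurable_fun [set: Omega] f.
Proof.
move=> /continuousP cf.
apply: (measurability _ (RGenOpens.measurableE R)) => _ [_ [a [b ->]] <-].
rewrite setTI; apply: open_measurable_pattern; apply: cf; exact: interval_open.
Qed.

End FlowTopology.

Section FlowDerivative.
Context {R : realType} {L0 : delone R}.
Local Notation Omega := (pattern_space L0).
Implicit Types (x : Omega) (s t : R) (f g psi : Omega -> R).

Lemma flow_derivable_linear (a : R) f g x : flow_derivable f x ->
  flow_derivable g x -> flow_derivable (a *: f + g) x /\
  flow_derive (a *: f + g) x = a * flow_derive f x + flow_derive g x.
Proof.
move=> df dg.
have H : diff_quotient (a *: f + g) x s @[s --> 0^'] -->
    a * flow_derive f x + flow_derive g x.
  rewrite (_ : diff_quotient _ x = fun s => a * diff_quotient f x s + diff_quotient g x s).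
    by apply: cvgD => //; apply: cvgM => //; exact: cvg_cst.
  apply/funext => s; rewrite /diff_quotient.
  have E y : (a *: f + g) y = a * f y + g y by [].
  by rewrite !E; ring.
by split; [apply/cvg_ex; eexists; exact: H|exact: cvg_lim H].
Qed.

Lemma flow_derivative_cst (c : R) x :
  flow_derivable (cst c) x /\ flow_derive (cst c) x = 0.
Proof.
have H : diff_quotient (cst c) x s @[s --> 0^'] --> (0 : R).
  rewrite (_ : diff_quotient _ x = cst 0); first exact: cvg_cst.
  by apply/funext => s; rewrite /diff_quotient subrr mul0r.
by split; [apply/cvg_ex; eexists; exact: H|exact: cvg_lim H].
Qed.

Lemma Cinfty_cst (c : R) : Cinfty (cst c : Omega -> R).
Proof.
have H n : exists c', iter n flow_derive (cst c : Omega -> R) = cst c'.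
  elim: n => [|n [c' IH]]; first by exists c.
  exists 0; rewrite iterS IH; apply/funext => x.
  exact: (flow_derivative_cst c' x).2.
move=> n; have [c' ->] := H n; split; first exact: cst_continuous.
by move=> x; case: (flow_derivative_cst c' x).
Qed.

Lemma Cinfty_linear (a : R) f g : Cinfty f -> Cinfty g -> Cinfty (a *: f + g).
Proof.
move=> Cf Cg.
have H n : iter n flow_derive (a *: f + g) =
    a *: iter n flow_derive f + iter n flow_derive g.
  elim: n => // n IH; rewrite !iterS IH; apply/funext => x.
  by rewrite (flow_derivable_linear a ((Cf n).2 x) ((Cg n).2 x)).2.
move=> n; rewrite H; split.
  move=> x; exact: (cvgD (cvgM (cvg_cst a) ((Cf n).1 x)) ((Cg n).1 x)).
by move=> x; case: (flow_derivable_linear a ((Cf n).2 x) ((Cg n).2 x)).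
Qed.

(** The group law of the flow makes the derivative at [0] one at every time. *)
Lemma flow_is_derive psi x s : (forall y, flow_derivable psi y) ->
  is_derive s 1 (fun u => psi (flow u x)) (flow_derive psi (flow s x)).
Proof.
move=> dpsi; have H : diff_quotient psi (flow s x) h @[h --> 0^'] -->
    flow_derive psi (flow s x) := dpsi (flow s x).
have H' : h^-1 *: (psi (flow (h *: 1 + s) x) - psi (flow s x)) @[h --> 0^'] -->
    flow_derive psi (flow s x).
  rewrite (_ : (fun h => _) = diff_quotient psi (flow s x))//.
  apply/funext => h; rewrite /diff_quotient flowD [h *: 1]mulr1.
  by rewrite [LHS]mulrC.
apply: DeriveDef; first by apply/cvg_ex; eexists; exact: H'.
by apply: cvg_lim H'.
Qed.

Lemma flow_lipschitz psi (M : R) x s : (forall y, flow_derivable psi y) ->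
  (forall y, `|flow_derive psi y| <= M) ->
  `|psi (flow s x) - psi x| <= M * `|s|.
Proof.
move=> dpsi bM.
have key a b : a <= b -> `|psi (flow b x) - psi (flow a x)| <= M * `|b - a|.
  move=> ab; have [||c _ ->] := @MVT_segment _ (fun u => psi (flow u x))
    (fun u => flow_derive psi (flow u x)) a b ab.
  - by move=> u _; exact: flow_is_derive.
  - apply: continuous_subspaceT => u.
    have /@ex_derive/derivable1_diffP/differentiable_continuous := flow_is_derive x u dpsi.
    exact.
  by rewrite normrM ler_wpM2r.
rewrite -{2}[x]flow0 -{2}[s]subr0.
by have [/key//|/ltW/key H] := leP 0 s; rewrite distrC (distrC s).
Qed.

Lemma diff_quotient_cvg psi x t : t != 0 -> flow_derivable psi x ->
  diff_quotient psi x (t / n.+1%:R) @[n --> \oo] --> flow_derive psi x.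
Proof.
move=> t0 dpsi; apply: cvg_comp (dpsi : diff_quotient psi x s @[s --> 0^'] --> _).
have t_cvg0 : t / n.+1%:R @[n --> \oo] --> (0 : R).
  rewrite -[X in _ --> X](mulr0 t); apply: cvgM; first exact: cvg_cst.
  exact: cvg_harmonic.
have t_neq0 n : t / n.+1%:R != 0 by rewrite mulf_neq0// invr_neq0// pnatr_eq0.
move=> A nA; have [N _ HN] := t_cvg0 _ nA.
by exists N => // n /HN /(_ (t_neq0 n)).
Qed.

End FlowDerivative.

(** * Increments of smooth functions in the mean *)

Section InvariantMeasure.
Context {R : realType} {L0 : delone R} {mu : probability (pattern_space L0) R}.
Local Notation Omega := (pattern_space L0).
Local Notation norm2 := (semi_norm (L2_inner mu)).
Implicit Types (x : Omega) (s t : R) (f g psi : Omega -> R).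
Hypothesis inv : invariant_measure mu.

Lemma integral_sq_flow t f : measurable_fun [set: Omega] f ->
  (\int[mu]_x (f (flow t x) ^+ 2)%:E = \int[mu]_x (f x ^+ 2)%:E)%E.
Proof.
move=> mf; have m2 : measurable_fun [set: Omega] (fun x => (f x ^+ 2)%:E).
  by apply/measurable_EFinP; exact: measurable_funX.
have := @ge0_integral_pushforward _ _ _ _ _ _ (@measurable_flow _ L0 t) mu
  setT _ measurableT m2.
rewrite preimage_setT => <-; last by move=> x _; rewrite lee_fin sqr_ge0.
apply: eq_measure_integral; first exact: measurable_flow.
by move=> mflow A mA _; exact: inv.
Qed.

Lemma L2_flow t f : L2 mu f -> L2 mu (f \o flow t).
Proof.
move=> /L2P[mf lf]; apply/L2P; split.
  by apply: measurableT_comp => //; exact: measurable_flow.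
by rewrite integral_sq_flow.
Qed.

Lemma norm2_flow t f : L2 mu f -> norm2 (f \o flow t) = norm2 f.
Proof.
move=> Lf; congr Num.sqrt; apply: EFin_inj.
rewrite !L2_inner_sqE//; last exact: L2_flow.
by rewrite integral_sq_flow//; exact: L2_measurable Lf.
Qed.

Local Notation increment s f := (f \o flow s - f).

Let L2_increment s f : L2 mu f -> L2 mu (increment s f).
Proof. by move=> Lf; exact: linear_setB (L2_linear mu) (L2_flow s Lf) Lf. Qed.

(** The increment over [s *+ n] is a telescoping sum of [n] translates of the
    increment over [s], all of the same norm by invariance. *)
Lemma norm2_increment_muln s n f : L2 mu f ->
  norm2 (increment (s *+ n) f) <= n%:R * norm2 (increment s f).
Proof.
move=> Lf; have BD := L2_semi_inner mu; elim: n => [|n IH].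
  rewrite mulr0n mul0r (_ : increment 0 f = 0 *: f).
    by rewrite /semi_norm (semi_inner_sqZ BD)// expr0n mul0r sqrtr0.
  by apply/funext => x; rewrite !fctE flow0 subrr scale0r.
rewrite (_ : increment _ f = increment s f \o flow (s *+ n) + increment (s *+ n) f).
  apply: le_trans (semi_norm_triangle BD _ _) _.
  - exact/L2_flow/L2_increment.
  - exact: L2_increment.
  rewrite norm2_flow; last exact: L2_increment.
  by rewrite -natr1 mulrDl mul1r addrC lerD2r.
by apply/funext => x; rewrite !fctE/= flowD -mulrS addrA subrK.
Qed.

Hypothesis flc : finite_local_complexity L0.

Lemma L2_continuous f : continuous f -> L2 mu f.
Proof.
move=> cf; have [M _ fM] := continuous_bounded flc cf.
by apply: L2_bounded fM; exact: continuous_measurable_pattern.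
Qed.

(** A mean value inequality in [L^2].  Splitting [t] into [n] steps bounds the
    increment by [`|t|] times the norm of a difference quotient with step
    [t / n], and these quotients converge to the derivative by dominated
    convergence, the domination coming from the pointwise mean value theorem. *)
Lemma norm2_increment_le t psi : Cinfty psi ->
  norm2 (increment t psi) <= `|t| * norm2 (flow_derive psi).
Proof.
move=> Cpsi; have BD := L2_semi_inner mu.
have cpsi : continuous psi := (Cpsi 0%N).1.
have dpsi : forall y, flow_derivable psi y := (Cpsi 0%N).2.
have cdpsi : continuous (flow_derive psi) := (Cpsi 1%N).1.
have Lpsi := L2_continuous cpsi; have Ldpsi := L2_continuous cdpsi.
have [->|t0] := eqVneq t 0.
  by have := norm2_increment_muln 0 0 Lpsi; rewrite mulr0n mul0r normr0 mul0r.
have [M M0 bM] := continuous_bounded flc cdpsi.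
pose s n : R := t / n.+1%:R.
have s0 n : s n != 0 by rewrite mulf_neq0// invr_neq0// pnatr_eq0.
pose q n : Omega -> R := fun x => diff_quotient psi x (s n).
have qE n : q n = (s n)^-1 *: increment (s n) psi.
  by apply/funext => x; rewrite /q /diff_quotient mulrC.
have Lq n : L2 mu (q n).
  by rewrite qE; apply: linear_setZ (L2_linear mu) _; exact: L2_increment.
have le_q n : norm2 (increment t psi) ^+ 2 <= t ^+ 2 * L2_inner mu (q n) (q n).
  have := norm2_increment_muln (s n) n.+1 Lpsi.
  rewrite (_ : s n *+ n.+1 = t); last first.
    by rewrite -mulr_natr /s divfK// pnatr_eq0.
  have tE : n.+1%:R * s n = t by rewrite mulrC /s divfK// pnatr_eq0.
  rewrite -[X in X ^+ 2 * _]tE.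
  have -> : increment (s n) psi = s n *: q n.
    by rewrite qE scalerA divff// scale1r.
  move=> H; rewrite exprMn -mulrA -(semi_inner_sqZ BD)// -(semi_norm_sq BD).
  by rewrite -exprMn lerXn2r ?nnegrE ?mulr_ge0 ?semi_norm_ge0.
have cvg_q : (\int[mu]_x (q n x ^+ 2)%:E)%E @[n --> \oo] -->
    (\int[mu]_x (flow_derive psi x ^+ 2)%:E)%E.
  apply: (@dominated_cvg _ _ _ _ _ _ _ _ (cst (M ^+ 2)%:E)) => //.
  - move=> n; apply/measurable_EFinP/measurable_funX.
    exact: L2_measurable (Lq n).
  - move=> x _; apply: cvg_EFin; first exact: nearW.
    have qx : q n x @[n --> \oo] --> flow_derive psi x.
      exact: diff_quotient_cvg.
    rewrite expr2 (_ : _ \o _ = fun n => q n x * q n x); first exact: cvgM.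
    by apply/funext => n /=; rewrite expr2.
  - exact: finite_measure_integrable_cst.
  - move=> n x _ /=; rewrite lee_fin normrX lerXn2r ?nnegrE ?(ltW M0)//.
    rewrite /q /diff_quotient normrM normfV ler_pdivrMr ?normr_gt0//.
    exact: flow_lipschitz.
rewrite -(@ler_pXn2r _ 2) ?nnegrE ?mulr_ge0 ?semi_norm_ge0//.
rewrite exprMn real_normK ?num_real// !(semi_norm_sq BD).
have t20 : 0 < t ^+ 2 by rewrite exprn_even_gt0//= t0.
rewrite -ler_pdivrMl// -lee_fin L2_inner_sqE//.
rewrite -(cvg_lim _ cvg_q)//; apply: lime_ge; first by apply/cvg_ex; eexists; exact: cvg_q.
apply: nearW => n; rewrite -L2_inner_sqE// lee_fin ler_pdivrMl//.
by rewrite -(semi_norm_sq BD).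
Qed.

End InvariantMeasure.

(** * Functions orthogonal to gradients are flow invariant *)

Section FlowInvariance.
Context {R : realType} {L0 : delone R} {mu : probability (pattern_space L0) R}.
Local Notation Omega := (pattern_space L0).
Local Notation norm2 := (semi_norm (L2_inner mu)).
Implicit Types (x : Omega) (s t : R) (f g psi : Omega -> R).
Hypothesis inv : invariant_measure mu.
Hypothesis flc : finite_local_complexity L0.

(** The pair [(g, 0)] lies in the closure of the graph of the derivative on smooth
    functions.  Let [z = (c, d)] be its component orthogonal to that graph:
    orthogonality says precisely that [c] is the weak derivative of [d].  So [g]
    is orthogonal to [c], hence [(g, 0)] to [z], and [z] has norm [0]. *)
Lemma Cinfty_approximation g : L2 mu g ->
  (forall d c, L2 mu d -> L2 mu c -> weak_derivative mu d c ->
     L2_inner mu g c = 0) ->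
  forall e, 0 < e -> exists psi, [/\ Cinfty psi, norm2 (g - psi) < e &
    norm2 (flow_derive psi) < e].
Proof.
move=> Lg gperp e e0; have BD := L2_semi_inner mu.
have L20 : L2 mu 0 by case: (L2_linear mu).
pose ip2 := prod_inner (L2_inner mu) (L2_inner mu).
pose V := [set (psi, flow_derive psi) | psi in [set psi : Omega -> R | Cinfty psi]].
have PD := prod_semi_inner BD BD.
have VD : V `<=` L2 mu `*` L2 mu.
  move=> _ [psi /= Cpsi <-]; split => /=; apply: L2_continuous => //.
    exact: (Cpsi 0%N).1.
  exact: (Cpsi 1%N).1.
have VL : linear_set V.
  split.
    exists (cst 0); first exact: Cinfty_cst.
    by congr pair; apply/funext => x; rewrite (flow_derivative_cst 0 x).2.
  move=> a _ _ [f /= Cf <-] [h /= Ch <-]; exists (a *: f + h).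
    exact: Cinfty_linear.
  congr pair; apply/funext => x.
  by rewrite (flow_derivable_linear a ((Cf 0%N).2 x) ((Ch 0%N).2 x)).2.
have [_ C P _] := BD; have DL2 := prod_linear_set (L2_linear mu) (L2_linear mu).
have [||v [Dv close perp]] := orthogonal_projection (u := (g, 0)) PD _ VD VL.
- exact: (prod_geometrically_complete P P (L2_complete (mu := mu))
    (L2_complete (mu := mu))).
- by split.
have Du : (L2 mu `*` L2 mu) (g, 0) by split.
pose z := (g, 0) - v : (Omega -> R) * (Omega -> R).
have Dz : (L2 mu `*` L2 mu) z := linear_setB DL2 Du Dv.
have zv : ip2 z v = 0 := orthogonal_closure PD VD Dz Dv perp close.
have wd : weak_derivative mu z.2 z.1.
  move=> psi Cpsi; apply/eqP; rewrite -subr_eq0 opprK; apply/eqP.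
  by apply: (perp (psi, flow_derive psi)); exists psi.
have gz1 : L2_inner mu g z.1 = 0 by apply: gperp wd; case: Dz.
have zz : ip2 z z = 0.
  have -> : ip2 z z = ip2 z (g, 0) - ip2 z v.
    by have := semi_innerBr PD Du Dv Dz.
  rewrite zv subr0 /ip2/prod_inner/= C gz1 add0r.
  rewrite /L2_inner; under eq_Rintegral do rewrite mulr0.
  by rewrite Rintegral_cst// mul0r.
have [_ [psi Cpsi <-] close_psi] := close (e ^+ 2) (exprn_gt0 2 e0).
set w := (psi, flow_derive psi) in close_psi.
have Dw : (L2 mu `*` L2 mu) w by apply: VD; exists psi.
have uw : semi_norm ip2 ((g, 0) - w) < e.
  have -> : (g, 0) - w = z + (v - w) by rewrite /z subrKA.
  apply: le_lt_trans (semi_norm_triangle PD Dz (linear_setB DL2 Dv Dw)) _.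
  have -> : semi_norm (prod_inner (L2_inner mu) (L2_inner mu)) z = 0.
    by rewrite /semi_norm [X in Num.sqrt X]zz sqrtr0.
  rewrite add0r -(@ltr_pXn2r _ 2) ?nnegrE ?semi_norm_ge0 ?ltW//.
  by rewrite (semi_norm_sq PD).
have Lpsi : L2 mu psi by case: Dw.
have Ldpsi : L2 mu (flow_derive psi) by case: Dw.
exists psi; split=> //; apply: le_lt_trans uw.
  by apply: ler_wsqrtr; rewrite lerDl P.
rewrite -(semi_norm_N BD) //; apply: ler_wsqrtr.
by rewrite -[- flow_derive psi]sub0r lerDr P.
Qed.

(** Approximate [g] by a smooth [psi] with small derivative: by
    [norm2_increment_le] the increment of [psi] is small, and by invariance of the
    measure so is that of [g]. *)
Lemma gradient_orthogonal_flow_invariant g : L2 mu g ->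
  (forall d c, L2 mu d -> L2 mu c -> weak_derivative mu d c ->
     L2_inner mu g c = 0) ->
  forall t, {ae mu, forall x, g (flow t x) = g x}.
Proof.
move=> Lg gperp t; have BD := L2_semi_inner mu.
have Lgt : L2 mu (g \o flow t) := L2_flow inv t Lg.
have LB : L2 mu (g \o flow t - g) by exact: linear_setB (L2_linear mu) Lgt Lg.
suff N0 : norm2 (g \o flow t - g) = 0.
  have /(L2_inner_eq0 LB) : L2_inner mu (g \o flow t - g) (g \o flow t - g) = 0.
    by rewrite -(semi_norm_sq BD) N0 expr0n.
  by apply: filterS => x /eqP; rewrite subr_eq0 => /eqP.
apply/eqP; rewrite eq_le semi_norm_ge0 andbT; apply/ler_addgt0Pr => e e0.
rewrite add0r.
have t2 : 0 < `|t| + 2 by rewrite ltr_wpDl.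
(* the increment of [psi] contributes the factor [`|t|], and [g - psi] occurs
   twice *)
have [psi [Cpsi gpsi dpsi]] :=
  Cinfty_approximation Lg gperp (divr_gt0 e0 t2).
have Lpsi := L2_continuous flc (Cpsi 0%N).1 : L2 mu psi.
have Lpsit : L2 mu (psi \o flow t) := L2_flow inv t Lpsi.
have Lgp : L2 mu (g - psi) by exact: linear_setB (L2_linear mu) _ _.
have Lgpt : L2 mu ((g - psi) \o flow t) := L2_flow inv t Lgp.
have Lpp : L2 mu (psi \o flow t - psi) by exact: linear_setB (L2_linear mu) _ _.
have -> : g \o flow t - g =
    (g - psi) \o flow t + ((psi \o flow t - psi) + (- (g - psi))).
  by apply/funext => x; rewrite !fctE/=; ring.
have LNgp : L2 mu (- (g - psi)).
  by rewrite -scaleN1r; exact: linear_setZ (L2_linear mu) _.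
apply: le_trans (semi_norm_triangle BD _ _) _ => //.
  exact: linear_setD (L2_linear mu) _ _.
rewrite norm2_flow//.
have := semi_norm_triangle BD Lpp LNgp; rewrite (semi_norm_N BD)//.
have := norm2_increment_le inv flc t Cpsi.
have : `|t| * norm2 (flow_derive psi) <= `|t| * (e / (`|t| + 2)).
  by rewrite ler_wpM2l// ltW.
have : (`|t| + 2) * (e / (`|t| + 2)) = e by rewrite mulrC divfK// gt_eqF.
lra.
Qed.

End FlowInvariance.

(** * Unique ergodicity forces invariant functions to be constant *)

Section AlmostEverywhere.
Context {d} {T : measurableType d} {R : realType} (mu : probability T R).

Lemma ae_iff_measure (A B : set T) : measurable A -> measurable B ->
  {ae mu, forall x, A x <-> B x} -> mu A = mu B.
Proof.
move=> mA mB AB; rewrite -[A]setIT -[B]setIT -!integral_indic//.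
apply: ae_eq_integral => //.
- by apply/measurable_EFinP; exact: measurable_indic.
- by apply/measurable_EFinP; exact: measurable_indic.
apply: filterS AB => x AB _; rewrite !indicE; congr (_%:R%:E).
by congr nat_of_bool; apply/idP/idP => /set_mem/AB/mem_set.
Qed.

Lemma ae_full (A : set T) : measurable A -> mu A = 1%E ->
  {ae mu, forall x, A x}.
Proof.
move=> mA A1; exists (~` A); split=> //; first exact: measurableC.
by rewrite probability_setC// A1 subee.
Qed.

End AlmostEverywhere.

Section Ergodicity.
Context {R : realType} {L0 : delone R} {mu : probability (pattern_space L0) R}.
Local Notation Omega := (pattern_space L0).
Hypothesis ue : uniquely_ergodic mu.

(** The measure conditioned on such a set is an invariant probability measure, so
    it equals [mu]; evaluate both on the set itself. *)
Lemma ae_invariant_set_full (A : set Omega) : measurable A ->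
  (forall t, {ae mu, forall x, A (flow t x) <-> A x}) ->
  mu A != 0%E -> mu A = 1%E.
Proof.
move=> mA invA A0; have [inv uniq] := ue.
pose nu : probability Omega R := mnormalize (mrestr mu mA) mu.
have fA : mu A \is a fin_num by exact: fin_num_measure.
(* [mnormalize] resorts to its second argument only for a null or infinite
   total mass *)
have nuE U : nu U = (mu (U `&` A) * ((fine (mu A))^-1)%:E)%E.
  rewrite /nu/= /mnormalize /mrestr /= -[LHS]/((if (mu ([set: Omega] `&` A) == 0)%E
    || (mu ([set: Omega] `&` A) == +oo)%E then mu : set Omega -> \bar R else
    fun V => mu (V `&` A) * ((fine (mu ([set: Omega] `&` A)))^-1)%:E)%E U).
  rewrite setTI (negbTE A0)/=; case: eqP => // Ay.
  by rewrite Ay in fA.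
rewrite -(uniq nu)//; last first.
  move=> t U mU; rewrite !nuE; congr (_ * _)%E.
  have mfl V : measurable V -> measurable (flow t @^-1` V : set Omega).
    by move=> mV; rewrite -[_ @^-1` _]setTI; exact: measurable_flow.
  rewrite -(inv t (U `&` A)); last exact: measurableI.
  apply: ae_iff_measure.
  - by apply: measurableI => //; exact: mfl.
  - by apply: mfl; exact: measurableI.
  apply: filterS (invA t) => x AtA /=.
  by split=> -[Ux /AtA].
rewrite nuE setIid -[X in (X * _)%E](fineK fA) -EFinM divff//.
by rewrite -eqe fineK.
Qed.

(** The set where [g] exceeds its mean has measure [0] or [1], and in the latter
    case the integral of the positive function [g - c] would vanish. *)
Lemma ae_le_mean (g : Omega -> R) : L2 mu g ->
  (forall t, {ae mu, forall x, g (flow t x) = g x}) ->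
  {ae mu, forall x, g x <= \int[mu]_y g y}.
Proof.
move=> Lg invg; set c := \int[mu]_y g y.
have mg := L2_measurable Lg.
pose A := [set x | c < g x].
have mA : measurable A.
  have -> : A = g @^-1` `]c, +oo[.
    by apply/seteqP; split=> x /=; rewrite in_itv/= andbT.
  by rewrite -[_ @^-1` _]setTI; apply: mg.
have [A0|A0] := eqVneq (mu A) 0%E.
  exists A; split=> // x /= /negP; by rewrite -ltNge.
have /(ae_full mA) aeA : mu A = 1%E.
  apply: ae_invariant_set_full => // t.
  by apply: filterS (invg t) => x; rewrite /A/= => ->.
have Lgc : L2 mu (g - cst c).
  by apply: linear_setB (L2_linear mu) Lg _; exact: L2_cst.
have mgc := L2_measurable Lgc.
have int0 : (\int[mu]_x `|(g x - c)%:E| = 0)%E.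
  transitivity (\int[mu]_x (g x - c)%:E)%E.
    apply: ae_eq_integral => //.
    - by apply: measurableT_comp => //; exact/measurable_EFinP.
    - exact/measurable_EFinP.
    by apply: filterS aeA => x gx _; rewrite gee0_abs// lee_fin subr_ge0 ltW.
  rewrite -[LHS]fineK; last first.
    by apply: integrable_fin_num => //; exact: L2_integrable Lgc.
  congr EFin; rewrite -[LHS]/(\int[mu]_x (g x - (cst c) x)).
  rewrite RintegralB//; [|exact: L2_integrable|exact/L2_integrable/L2_cst].
  rewrite Rintegral_cst// -/c.
  have -> : fine (mu [set: Omega]) = 1 by rewrite -[RHS]/(fine 1) -(probability_setT mu).
  by rewrite mulr1 subrr.
have ae0 : ae_eq mu [set: Omega] (fun x => (g x - c)%:E) (cst 0%E).
  by apply/ae_eq_integral_abs => //; exact/measurable_EFinP.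
apply: filterS2 aeA ae0 => x gx /(_ I)[] /eqP.
by rewrite subr_eq0 => /eqP ->.
Qed.

Lemma ae_constant (g : Omega -> R) : L2 mu g ->
  (forall t, {ae mu, forall x, g (flow t x) = g x}) ->
  {ae mu, forall x, g x = \int[mu]_y g y}.
Proof.
move=> Lg invg; have LNg : L2 mu (- g).
  by rewrite -scaleN1r; exact: linear_setZ (L2_linear mu) Lg.
have le := ae_le_mean Lg invg.
have ge : {ae mu, forall x, (- g) x <= \int[mu]_y (- g) y}.
  apply: ae_le_mean => // t.
  by apply: filterS (invg t) => x E; rewrite !fctE E.
apply: filterS2 le ge => x gle.
rewrite (_ : \int[mu]_y (- g) y = - \int[mu]_y g y); last first.
  rewrite -[RHS]mulN1r -RintegralZl//; last exact: L2_integrable.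
  by apply: eq_Rintegral => y _; rewrite mulN1r.
by rewrite lerN2 => gge; apply/eqP; rewrite eq_le gle.
Qed.

End Ergodicity.

(** * The decomposition *)

Section Fields.
Context {R : realType} {L0 : delone R} (mu : probability (pattern_space L0) R).
Local Notation Omega := (pattern_space L0).
Implicit Types (f g h : Omega -> R).

Lemma scale_e1E (a : R) : (a *: @e1 R) 0 0 = a.
Proof. by rewrite !mxE mulr1. Qed.

Lemma inner_star f g : inner mu (star f) (star g) = L2_inner mu f g.
Proof.
apply: eq_Rintegral => x _.
by rewrite /dotv mxE big_ord1 [_^T _ _]mxE !scale_e1E.
Qed.

Lemma starB f g : star f \- star g = star (f - g).
Proof. by apply/funext => x; rewrite /star /hodge_star/= -scalerBl. Qed.

Lemma square_integrableP v : square_integrable mu v <->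
  exists2 f, L2 mu f & v = star f.
Proof. by split=> [[f Lf <-]|[f Lf ->]]; exists f. Qed.

Lemma square_integrable_star f : L2 mu f -> square_integrable mu (star f).
Proof. by exists f. Qed.

(** The range of the gradient, seen as a space of functions through [star]. *)
Definition weak_derivatives : set (Omega -> R) :=
  [set c | L2 mu c /\ exists2 d, L2 mu d & weak_derivative mu d c].

Lemma im_gradientP v : im_gradient mu v <->
  exists2 c, weak_derivatives c & v = star c.
Proof.
split=> [[d [Ld [c [Lc dc ->]]]]|[c [Lc [d Ld dc]] ->]].
  by exists c => //; split=> //; exists d.
by exists d; split=> //; exists c.
Qed.

Lemma im_gradient_star c : weak_derivatives c -> im_gradient mu (star c).
Proof. by move=> Wc; apply/im_gradientP; exists c. Qed.

(** Test the weak derivative against a constant, whose derivative vanishes. *)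
Lemma weak_derivative_cst_orthogonal d c (a : R) :
  weak_derivative mu d c -> L2_inner mu c (cst a) = 0.
Proof.
move=> /(_ _ (@Cinfty_cst _ L0 a)); rewrite /L2_inner => ->.
under eq_Rintegral do rewrite (flow_derivative_cst a _).2 mulr0.
by rewrite Rintegral_cst// mul0r oppr0.
Qed.

Hypothesis flc : finite_local_complexity L0.

Lemma weak_derivatives_linear : linear_set weak_derivatives.
Proof.
have [[L20 L2D] _ _ lin] := L2_semi_inner mu.
split.
  split=> //; exists 0 => // psi Cpsi.
  rewrite -[LHS]/(L2_inner mu (cst 0) psi) /L2_inner.
  under eq_Rintegral do rewrite mul0r.
  under [in RHS]eq_Rintegral do rewrite mul0r.
  by rewrite Rintegral_cst// mul0r oppr0.
move=> a c1 c2 [Lc1 [d1 Ld1 dc1]] [Lc2 [d2 Ld2 dc2]].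
split; first exact: L2D.
exists (a *: d1 + d2); first exact: L2D.
move=> psi Cpsi.
have Lpsi := L2_continuous flc (Cpsi 0%N).1 : L2 mu psi.
have Ldpsi := L2_continuous flc (Cpsi 1%N).1 : L2 mu (flow_derive psi).
have := lin a _ _ _ Lc1 Lc2 Lpsi; rewrite /L2_inner => ->.
have := lin a _ _ _ Ld1 Ld2 Ldpsi; rewrite /L2_inner => ->.
by rewrite (dc1 _ Cpsi) (dc2 _ Cpsi) opprD mulrN.
Qed.

Lemma orth_complP w : orth_compl mu (im_gradient mu) w <->
  exists h, [/\ L2 mu h, w = star h &
    forall c, weak_derivatives c -> L2_inner mu h c = 0].
Proof.
have [_ C _ _] := L2_semi_inner mu; split.
  move=> [/square_integrableP[h Lh ->] wperp]; exists h; split=> // c Wc.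
  by rewrite C -inner_star; apply/wperp/im_gradient_star.
move=> [h [Lh -> hperp]]; split; first exact: square_integrable_star.
by move=> _ /im_gradientP[c Wc ->]; rewrite inner_star C hperp.
Qed.

Lemma helmholtz_decomposition :
  orthogonal_decomposition mu (L2_closure mu (im_gradient mu))
    (orth_compl mu (im_gradient mu)).
Proof.
have BD := L2_semi_inner mu; have [_ C _ _] := BD.
have WL2 : weak_derivatives `<=` L2 mu by move=> c [].
split; [by move=> v []|by move=> v []| |].
  move=> _ _ [/square_integrableP[f Lf ->] close] /orth_complP[h [Lh -> hperp]].
  rewrite inner_star C; apply: (orthogonal_closure BD WL2) => // e e0.
  have se0 : 0 < Num.sqrt e by rewrite sqrtr_gt0.
  have [_ /im_gradientP[c Wc ->]] := close _ se0.
  by rewrite starB inner_star ltr_sqrt// => fc; exists c.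
move=> _ /square_integrableP[u Lu ->].
have [v [Lv close perp]] := orthogonal_projection BD (L2_complete (mu := mu))
  WL2 weak_derivatives_linear Lu.
exists (star v), (star (u - v)); split.
- split; first exact: square_integrable_star.
  move=> e e0; have [c Wc fc] := close _ (exprn_gt0 2 e0).
  exists (star c); first exact: im_gradient_star.
  rewrite starB inner_star -(@ltr_pXn2r _ 2) ?nnegrE ?sqrtr_ge0 ?ltW//.
  by rewrite sqr_sqrtr//; case: BD.
- apply/orth_complP; exists (u - v); split=> //.
  exact: linear_setB (L2_linear mu) Lu Lv.
- by apply: aeW => x; rewrite /star /hodge_star/= -scalerDl addrC subrK.
Qed.

Lemma orth_compl_im_gradient : uniquely_ergodic mu ->
  orth_compl mu (im_gradient mu) =
    L2_classes mu [set star (cst c) | c in [set: R]].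
Proof.
move=> ue; have [inv _] := ue; apply/seteqP; split.
  move=> _ /orth_complP[h [Lh -> hperp]].
  split; first exact: square_integrable_star.
  have hcst : {ae mu, forall x, h x = \int[mu]_y h y}.
    apply: ae_constant => // t; apply: gradient_orthogonal_flow_invariant => //.
    by move=> d c Ld Lc dc; apply: hperp; split=> //; exists d.
  exists (star (cst (\int[mu]_y h y))); first by exists (\int[mu]_y h y).
  by apply: filterS hcst => x hx; rewrite /star /hodge_star hx.
move=> _ [/square_integrableP[h Lh ->] [_ [a _ <-] ha]].
apply/orth_complP; exists h; split=> // c [Lc [d Ld dc]].
rewrite -(weak_derivative_cst_orthogonal a dc) /L2_inner; congr fine.
have mh := L2_measurable Lh; have mc := L2_measurable Lc.
apply: ae_eq_integral => //.
- by apply/measurable_EFinP; exact: measurable_funM.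
- by apply/measurable_EFinP; exact: measurable_funM.
apply: filterS ha => x hx _; rewrite mulrC.
by rewrite -[h x]scale_e1E [h x *: _]hx scale_e1E.
Qed.

End Fields.

Theorem theorem5 (R : realType) (L0 : delone R)
    (mu : probability (pattern_space L0) R) :
  aperiodic L0 -> repetitive L0 -> finite_local_complexity L0 ->
  uniquely_ergodic mu ->
  [/\ orthogonal_decomposition mu (L2_closure mu (im_gradient mu))
        (orth_compl mu (im_gradient mu)),
      one_dimensional mu (orth_compl mu (im_gradient mu)) &
      orth_compl mu (im_gradient mu) =
        L2_classes mu [set star (cst c) | c in [set: R]]].
Proof.
move=> _ _ flc ue.
have decomp := helmholtz_decomposition mu flc.
have orthE := orth_compl_im_gradient flc ue.
split=> //; exists (star (cst 1)); split.
- rewrite orthE; split; first by apply/square_integrable_star/L2_cst.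
  by exists (star (cst 1)); [exists 1|exact: aeW].
- move=> [N [mN N0 sub]].
  have : N = [set: pattern_space L0].
    apply/seteqP; split=> // x _; apply: sub => /= /(congr1 (fun A : 'rV[R]_1 => A 0 0)).
    by rewrite scale_e1E mxE; apply/eqP; rewrite oner_eq0.
  move=> NT; have := probability_setT mu; rewrite -NT N0 => /eqP.
  by rewrite eq_sym onee_eq0.
- rewrite orthE; congr (L2_classes mu); apply/seteqP; split.
    move=> _ [a _ <-]; exists a => //; apply/funext => x.
    by rewrite /star /hodge_star/= scalerA mulr1.
  move=> _ [a _ <-]; exists a => //; apply/funext => x.
  by rewrite /star /hodge_star/= scalerA mulr1.
Qed.
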